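(* Let $G$ be an $n$-unexceptional $2$-connected graph of order $n \ge 6$. Then $\eta(G) \ge 2n-4$.
   Context: All graphs are finite, simple and connected; the order of a graph is its number of vertices. Let $d_G(u,v)$ be the usual shortest-path distance. The Wiener index is $W(G)=\sum_{\{u,v\}\subseteq V(G)} d_G(u,v)$, the sum being over unordered pairs of distinct vertices. For an edge $ab\in E(G)$ let $n_{ab}(a)=|\{c\in V(G): d_G(c,a)<d_G(c,b)\}|$ and $n_{ab}(b)=|\{c\in V(G): d_G(c,b)<d_G(c,a)\}|$. The Szeged index is $Sz(G)=\sum_{ab\in E(G)} n_{ab}(a)\,n_{ab}(b)$. The Szeged--Wiener gap is $\eta(G)=Sz(G)-W(G)$. For integers $n,t$ with $1\le t\le n-1$, $K_n^t$ denotes the graph of order $n$ obtained from the complete graph $K_{n-1}$ by adding one new vertex adjacent to exactly $t$ vertices of $K_{n-1}$. A graph $G$ is $n$-exceptional if it is isomorphic to one of $K_n$, $K_n^2$, $K_n^{n-2}$, and $n$-unexceptional otherwise. *)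

(* Defs.v *)
From mathcomp Require Import all_boot all_order all_algebra.

Set Implicit Arguments.
Unset Strict Implicit.
Unset Printing Implicit Defensive.

Record sgraph := SGraph {
  vertex :> finType;
  adj : rel vertex;
  adj_sym : symmetric adj;
  adj_irr : irreflexive adj
}.

Definition walk (G : sgraph) (k : nat) (u v : G) : bool :=
  [exists p : k.-tuple G, path (@adj G) u p && (last u p == v)].

(* Least length of a walk from u to v. Lengths below #|G| suffice for connected
   u and v (see distP); the value is #|G| when v is not reachable from u. *)
Definition dist (G : sgraph) (u v : G) : nat :=
  find (fun k => walk k u v) (iota 0 #|G|).

Definition connected_on (G : sgraph) (A : {set G}) : Prop :=
  {in A &, forall u v, connect [rel x y in A | adj x y] u v}.

(* X = set0 is among the deleted sets, so k.+1-connected graphs are connected. *)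
Definition k_connected (k : nat) (G : sgraph) : Prop :=
  k < #|G| /\ (forall X : {set G}, #|X| < k -> connected_on (~: X)).

(* Since the distance is symmetric, ordering each pair by enum_rank makes the
   sums below range over unordered pairs, each one counted once. *)
Definition wiener (G : sgraph) : nat :=
  \sum_(u : G) \sum_(v : G | enum_rank u < enum_rank v) dist u v.

Definition closer (G : sgraph) (a b : G) : nat :=
  #|[set c : G | dist c a < dist c b]|.

Definition szeged (G : sgraph) : nat :=
  \sum_(a : G) \sum_(b : G | adj a b && (enum_rank a < enum_rank b))
    closer a b * closer b a.

Definition sz_w_gap (G : sgraph) : int :=
  ((szeged G)%:Z - (wiener G)%:Z)%R.

Definition graph_iso (G H : sgraph) : Prop :=
  exists2 f : G -> H, bijective f & forall u v : G, adj (f u) (f v) = adj u v.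

Definition complete_rel (T : finType) : rel T := [rel x y | x != y].

Lemma complete_rel_sym (T : finType) : symmetric (@complete_rel T).
Proof. by move=> x y; rewrite /complete_rel /= eq_sym. Qed.

Lemma complete_rel_irr (T : finType) : irreflexive (@complete_rel T).
Proof. by move=> x; rewrite /complete_rel /= eqxx. Qed.

Definition complete_graph (n : nat) : sgraph :=
  SGraph (@complete_rel_sym 'I_n) (@complete_rel_irr 'I_n).

(* The added vertex is None; its neighbours are the first t vertices of
   K_(n-1), which is no loss up to isomorphism. Meant for 1 <= t <= n - 1. *)
Definition ext_complete_rel (n t : nat) : rel (option 'I_n.-1) :=
  fun x y =>
    match x, y with
    | Some i, Some j => i != j
    | Some i, None | None, Some i => i < t
    | None, None => false
    end.

Lemma ext_complete_rel_sym n t : symmetric (@ext_complete_rel n t).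
Proof. by case=> [i|] [j|] //=; rewrite eq_sym. Qed.

Lemma ext_complete_rel_irr n t : irreflexive (@ext_complete_rel n t).
Proof. by case=> [i|] //=; rewrite eqxx. Qed.

Definition ext_complete_graph (n t : nat) : sgraph :=
  SGraph (@ext_complete_rel_sym n t) (@ext_complete_rel_irr n t).

Definition exceptional (n : nat) (G : sgraph) : Prop :=
  [\/ graph_iso G (complete_graph n),
      graph_iso G (ext_complete_graph n 2) |
      graph_iso G (ext_complete_graph n (n - 2))].

Definition unexceptional (n : nat) (G : sgraph) : Prop := ~ exceptional n G.

Lemma dist_le (G : sgraph) (u : G) (p : seq G) :
  path (@adj G) u p -> dist u (last u p) <= size p.
Proof.
move=> up; rewrite leqNgt; apply/negP => lt_p.
have lt_pG : size p < #|G|.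
  by apply: leq_trans lt_p _; rewrite -[X in _ <= X](size_iota 0) find_size.
have := before_find 0 lt_p; rewrite nth_iota // add0n => /negbT/existsP[].
by exists (in_tuple p); rewrite up eqxx.
Qed.

Lemma distP (G : sgraph) (u v : G) :
  connect (@adj G) u v ->
  exists p, [/\ path (@adj G) u p, last u p = v & size p = dist u v].
Proof.
case/connectP => p0 up0 ->; case/shortenP: up0 => p up Up _.
have lt_pG : size p < #|G| by rewrite -[_.+1](card_uniqP Up) max_card.
have lt_d : dist u (last u p) < #|G| := leq_ltn_trans (dist_le up) lt_pG.
have /(nth_find 0) : has (fun k => walk k u (last u p)) (iota 0 #|G|).
  by rewrite has_find size_iota.
rewrite -/(dist _ _) nth_iota // add0n => /existsP[q /andP[uq /eqP lq]].
by exists q; rewrite size_tuple.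
Qed.

Lemma card_ext_complete_graph n t : 0 < n -> #|ext_complete_graph n t| = n.
Proof. by move=> n_gt0; rewrite /= card_option card_ord prednK. Qed.

(* Main.v *)
(* Call an edge good for the pair [u, v] if one of its ends is strictly closer to [u] and
   the other one strictly closer to [v]. Double counting shows that twice the gap is the
   sum, over the ordered pairs [u, v], of the excess #good - dist u v. It is nonnegative
   because the edges of a geodesic are good, it is positive if some good edge is on no
   geodesic, and at least 2 if two geodesics differ. One has to prove that the excesses add
   up to at least 4n - 8.

   Suppose that a vertex w is adjacent to all others. Then each induced path on 3 vertices
   of G - w adds 2 to the excess of its two ends, and each induced path on 4 vertices adds 1.
   Every vertex added to a connected, noncomplete set of vertices of G - w creates a new
   induced path on 3 vertices, so a small set with one path more than the bare minimum
   suffices; if there is none, then G is exceptional.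

   Suppose that there is no such w. If the excesses of the pairs containing x add up to at
   least 4 for every x, we are done. Otherwise 2-connectedness determines the shape of G
   seen from some x: either x has a single non-neighbour and this one has degree 2, or x lies
   on a 5-cycle through which the non-neighbours of x are attached to the rest. In both cases
   every vertex outside a fixed 4-cycle or 5-cycle has excesses with its vertices that add
   up to at least 2, which is 4 for ordered pairs. The only obstruction is a 5-cycle with two
   chords at the same vertex (a gem); then the vertices on the near side of this 5-cycle can
   be removed without changing distances, and one concludes by induction on the order. *)

Require Import Defs.
From mathcomp Require Import all_boot all_order all_algebra.
From mathcomp Require Import zify.

Set Implicit Arguments.
Unset Strict Implicit.
Unset Printing Implicit Defensive.

(* A constant, because the elaborated forms of [#|G|] differ syntactically. *)
Definition gorder (G : sgraph) : nat := #|G|.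

(** Edges are oriented away from [u]; at most one orientation of an edge passes the test, so each
    good edge is counted once. *)
Definition good (G : sgraph) (u v : G) : {set G * G} :=
  [set e | [&& adj e.1 e.2, dist u e.1 < dist u e.2 & dist v e.2 < dist v e.1]].

(** In a connected graph the subtraction never truncates, see [goodE]. *)
Definition excess (G : sgraph) (u v : G) : nat := #|good u v| - dist u v.

Definition total_excess (G : sgraph) : nat := \sum_(u : G) \sum_(v : G) excess u v.

Definition excess_to (G : sgraph) (S : {set G}) (y : G) := \sum_(s in S) excess y s.

Definition inner_excess (G : sgraph) (S : {set G}) := \sum_(u in S) excess_to S u.

(** * Arithmetic with distances *)

Ltac dist_sym_hyp distC a b :=
  lazymatch goal with
  | _ : dist a b = dist b a |- _ => fail
  | _ : dist b a = dist a b |- _ => fail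
  | _ => assert (dist a b = dist b a) by exact (distC a b)
  end.

Ltac clear_non_dist :=
  repeat match goal with
  | H : ?T |- _ =>
    lazymatch T with
    | forall _, _ => clear H
    | context [dist _ _] => fail
    | context [excess _ _] => fail
    | context [excess_to _ _] => fail
    | context [total_excess _] => fail
    | context [inner_excess _] => fail
    | context [gorder _] => fail
    | @eq nat _ _ => fail
    | nat => fail
    | _ => clear H
    end
  end.

(** To [lia] the terms [dist a b] and [dist b a] are unrelated atoms, so the symmetry equations are
    supplied first. *)
Ltac dlia distC :=
  repeat match goal with
  | |- context [dist ?a ?b] => dist_sym_hyp distC a b
  | _ : context [dist ?a ?b] |- _ => dist_sym_hyp distC a b
  end; clear_non_dist; lia.

Ltac neqs :=
  rewrite /= ?inE ?negb_or; repeat match goal with |- is_true (_ && _) => apply/andP; split end;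
  first [done | by rewrite eq_sym].

Ltac neq_rw :=
  repeat match goal with
  | H : is_true (?a != ?b) |- _ =>
    rewrite ?(negPf H) ?(etrans (eq_sym b a) (negPf H)); clear H
  end; rewrite /= ?andbF ?orbF.

Lemma connect_exit (T : finType) (e : rel T) (X : {set T}) u v :
  connect e u v -> u \in X -> v \notin X ->
  exists a b, [/\ a \in X, b \notin X & e a b].
Proof.
case/connectP => p; elim: p u => [|z p IH] u /=; first by move=> _ -> ->.
case/andP => uz zp Ev uX vX; have [zX|zX] := boolP (z \in X); first exact: (IH z).
by exists u, z.
Qed.

(* [x, w, b, z, w'] is a 5-cycle, and [B :|: B'] is the set of non-neighbours of [x].
   [B] is attached to the rest of the graph only by [w] and by the edge [bz], and [B']
   only by [w'] and [bz], except that [z] may also be adjacent to [w] if [B'] is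
   the singleton of [z]. *)
Record pentagon (G : sgraph) (x w w' b z : G) (B B' : {set G}) : Prop := Pentagon {
  pent_xw : adj x w;
  pent_xw' : adj x w';
  pent_ww' : w != w';
  pent_bB : b \in B;
  pent_zB' : z \in B';
  pent_wb : adj w b;
  pent_w'z : adj w' z;
  pent_bz : adj b z;
  pent_far : forall y, (y \in B) || (y \in B') = (y != x) && ~~ adj x y;
  pent_disj : forall y, y \in B -> y \notin B';
  pent_B : forall y q, y \in B -> adj y q ->
    [|| q \in B, q == w | (y == b) && (q == z)];
  pent_B' : forall y q, y \in B' -> adj y q ->
    [|| q \in B', q == w', (y == z) && (q == b) |
        [&& y == z, q == w & B' == [set z]]]
}.

(** The possible edge [zw] is the only asymmetry between the two sides of a pentagon. *)
Lemma pentagon_swap (G : sgraph) (x w w' b z : G) (B B' : {set G}) :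
  pentagon x w w' b z B B' -> ~~ adj z w -> pentagon x w' w z b B' B.
Proof.
case=> xw xw' ww' bB zB' wb w'z bz far disj nB nB' zw; split=> //.
- by rewrite eq_sym.
- by rewrite adj_sym.
- by move=> y; rewrite orbC.
- by move=> y yB'; apply/negP => /disj; rewrite yB'.
- move=> y q yB' yq; case/or4P: (nB' y q yB' yq) => [->|->|->|/and3P[/eqP E1 /eqP E2 _]]; rewrite ?orbT //.
  by rewrite -E1 -E2 yq in zw.
by move=> y q yB yq; case/or3P: (nB y q yB yq) => ->; rewrite ?orbT.
Qed.

Notation pentagon_set x w w' b z := [set s in [:: x; w; w'; b; z]].

Lemma pentagon_set_swap (G : sgraph) (x w w' b z : G) :
  pentagon_set x w w' b z = pentagon_set x w' w z b :> {set G}.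
Proof. by apply/setP => t; rewrite !inE; congr (_ || _); rewrite orbCA; do 2!congr (_ || _); rewrite orbC. Qed.

(* Induced paths [u - z - v], encoded as [(u, z, v)], and [a - b - c - d], encoded
   as [((a, b), (c, d))]. *)
Definition path3 (G : sgraph) (t : G * G * G) : bool :=
  [&& t.1.1 != t.2, ~~ adj t.1.1 t.2, adj t.1.1 t.1.2 & adj t.1.2 t.2].

Definition path4 (G : sgraph) (t : (G * G) * (G * G)) : bool :=
  [&& path3 (t.1.1, t.1.2, t.2.1), path3 (t.1.2, t.2.1, t.2.2), t.1.1 != t.2.2
    & ~~ adj t.1.1 t.2.2].

(** * Isometric induced subgraphs *)

Section Induced.
Variables (G : sgraph) (Q : {set G}).

Definition induced_rel : rel {v : G | v \in Q} := fun u v => adj (val u) (val v).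

Lemma induced_rel_sym : symmetric induced_rel.
Proof. by move=> u v; exact: adj_sym. Qed.

Lemma induced_rel_irr : irreflexive induced_rel.
Proof. by move=> u; exact: adj_irr. Qed.

Definition induced : sgraph := SGraph induced_rel_sym induced_rel_irr.

Lemma gorder_induced : gorder induced = #|Q|.
Proof. by rewrite /gorder card_sig. Qed.

Hypothesis geodesic : forall u v, u \in Q -> v \in Q -> u != v ->
  exists2 q, q \in Q & adj u q /\ dist q v < dist u v.

(** Each use of [geodesic] moves to a vertex of [Q] nearer to the target, so a greedy descent stays
    in [Q] and is no longer than the distance in [G]. Thus [Q] is isometric. *)
Lemma induced_path (u v : induced) :
  exists p, [/\ path (@adj induced) u p, last u p = v & size p <= dist (val u) (val v)].
Proof.
move Ek: (dist (val u) (val v)) => k; elim/ltn_ind: k u Ek => k IH u Ek.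
have [->|uv] := eqVneq u v; first by exists [::].
have [q qQ [uq dq]] := geodesic (valP u) (valP v) uv.
rewrite Ek in dq; have [p [qp lp sp]] := IH _ dq (Sub q qQ) erefl.
exists (Sub q qQ :: p); split=> //=; last by apply: leq_ltn_trans sp _.
by rewrite qp andbT.
Qed.

Lemma induced_connect (u v : induced) : connect (@adj induced) u v.
Proof. by have [p [up <- _]] := induced_path u v; apply/connectP; exists p. Qed.

Lemma dist_induced (u v : induced) : dist u v = dist (val u) (val v).
Proof.
apply/eqP; rewrite eqn_leq; apply/andP; split.
  by have [p [up <- sp]] := induced_path u v; apply: leq_trans (dist_le up) sp.
have [p [up <- <-]] := distP (induced_connect u v).
rewrite -(last_map val) -(size_map val); apply: dist_le.
by rewrite path_map.
Qed.

End Induced.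

(** In an exceptional graph every nonedge contains the added vertex, so two disjoint nonedges
    certify that a graph is unexceptional. *)
Lemma exceptional_no_two_nonedges n (H : sgraph) (a b c d : H) : exceptional n H ->
  uniq [:: a; b; c; d] -> ~~ adj a b -> ~~ adj c d -> False.
Proof.
have ext t : graph_iso H (ext_complete_graph n t) ->
    uniq [:: a; b; c; d] -> ~~ adj a b -> ~~ adj c d -> False.
  case=> f /bij_inj injf fadj; rewrite /= !inE !negb_or.
  case/and4P => /and3P[nab nac nad] /andP[nbc nbd] ncd _ ab cd.
  have nn u v : u != v -> ~~ adj u v -> f u = None \/ f v = None.
    rewrite -fadj -(inj_eq injf).
    by case: (f u) (f v) => [i|] [j|]; [move=> /= h; rewrite (_ : i != j) | right|left|left].
  case: (nn a b nab ab) => E; case: (nn c d ncd cd) => E';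
    have E0 := injf _ _ (etrans E (esym E')).
  - by rewrite E0 eqxx in nac.
  - by rewrite E0 eqxx in nad.
  - by rewrite E0 eqxx in nbc.
  by rewrite E0 eqxx in nbd.
case=> [[f /bij_inj injf fadj]|/ext|/ext] //.
rewrite -!fadj /= /complete_rel /= !(inj_eq injf) inE !negb_or => /and3P[/and3P[ab _ _] _ _].
by rewrite ab.
Qed.

Section Graph.
Variable G : sgraph.
Implicit Types (u v w x y z a b q : G).


(** * Distances and the excess of a pair *)

Lemma adj_neq u v : adj u v -> u != v.
Proof. by move=> uv; apply/eqP => E; rewrite E adj_irr in uv. Qed.

Lemma sum_sym_half (P : rel G) (F : G -> G -> nat) :
  symmetric P -> irreflexive P -> (forall u v, F u v = F v u) ->
  \sum_u \sum_(v | P u v) F u v =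
  (\sum_u \sum_(v | P u v && (enum_rank u < enum_rank v)) F u v).*2.
Proof.
move=> symP irrP symF.
have split_sum : \sum_u \sum_(v | P u v) F u v =
    \sum_u \sum_(v | P u v && (enum_rank u < enum_rank v)) F u v +
    \sum_u \sum_(v | P u v && (enum_rank v < enum_rank u)) F u v.
  rewrite -big_split; apply: eq_bigr => u _ /=.
  rewrite (bigID (fun v => enum_rank u < enum_rank v)) /=; congr (_ + _).
  apply: eq_bigl => v; case Puv: (P u v) => //=.
  rewrite -leqNgt leq_eqVlt; case: eqP => // /val_inj/enum_rank_inj E.
  by rewrite E irrP in Puv.
rewrite split_sum -addnn; congr (_ + _).
rewrite (exchange_big_dep predT) //=; apply: eq_bigr => u _.
by apply: eq_big => [v|v _]; [rewrite symP | rewrite symF].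
Qed.

Hypothesis conn : forall u v, connect (@adj G) u v.

Lemma dist0 u : dist u u = 0.
Proof. by apply/eqP; rewrite -leqn0; apply: (@dist_le _ u [::]). Qed.

Lemma dist_eq0 u v : (dist u v == 0) = (u == v).
Proof.
apply/eqP/eqP => [d0|->]; last exact: dist0.
by have [[|z p] [_ lp sp]] := distP (conn u v); rewrite d0 in sp.
Qed.

Lemma distC u v : dist u v = dist v u.
Proof.
suff le_d (x y : G) : dist x y <= dist y x by apply/eqP; rewrite eqn_leq !le_d.
have [p [yp lp <-]] := distP (conn y x).
have := rev_path (@adj G) y p; rewrite lp (@eq_path _ _ (@adj G)) => [rp|a b]; last by rewrite adj_sym.
rewrite yp in rp; have := dist_le rp.
suff -> : last x (rev (belast y p)) = y by rewrite size_rev size_belast.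
by case: p {yp rp} lp => [|z p] //= _; rewrite rev_cons last_rcons.
Qed.

Lemma dist_tri v u z : dist u z <= dist u v + dist v z.
Proof.
have [p [up <- <-]] := distP (conn u v).
have [q [vq <- <-]] := distP (conn (last u p) z).
by rewrite -last_cat -size_cat; apply: dist_le; rewrite cat_path up.
Qed.

Lemma dist_adj_le u v : adj u v -> dist u v <= 1.
Proof. by move=> uv; apply: (@dist_le _ u [:: v]); rewrite /= uv. Qed.

Lemma dist_eq1 u v : (dist u v == 1) = adj u v.
Proof.
apply/eqP/idP => [d1|uv].
  have [[|z [|y p]] [up lp sp]] := distP (conn u v); rewrite d1 // in sp.
  by move: up lp => /= /andP[uz _] <-.
apply/eqP; rewrite eqn_leq dist_adj_le // lt0n dist_eq0.
exact: adj_neq.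
Qed.

Lemma adj_dist1 u v : adj u v -> dist u v = 1.
Proof. by rewrite -dist_eq1 => /eqP. Qed.

Lemma dist_step v u z : adj u z -> dist v z <= (dist v u).+1.
Proof. by move=> /adj_dist1 uz; rewrite -addn1 -uz dist_tri. Qed.

Lemma nadj_dist u v : u != v -> ~~ adj u v -> 1 < dist u v.
Proof. by rewrite -dist_eq0 -dist_eq1; lia. Qed.

Lemma dist_pred u v k : dist u v = k.+1 -> exists2 z, adj z v & dist u z = k.
Proof.
have [p [up lp sp]] := distP (conn u v); move=> d; rewrite d in sp.
case/lastP: p up lp sp => // p z; rewrite rcons_path last_rcons size_rcons.
move=> /andP[up lz] Ez [sp]; rewrite {}Ez in lz; exists (last u p) => //.
have := dist_le up; have := dist_tri (last u p) u v; rewrite (adj_dist1 lz).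
lia.
Qed.

Lemma dist_at u v i : i <= dist u v ->
  exists2 a, dist u a = i & dist a v = dist u v - i.
Proof.
move Ek: (dist u v - i) => k; elim: k v i Ek => [|k IH] v i Ek le_i.
  by exists v; rewrite ?dist0 //; lia.
have [|z zv dz] := @dist_pred u v (dist u v).-1; first lia.
have [||a da az] := IH z i; [lia..|].
exists a => //; have := dist_step a zv; have := dist_tri a u v; lia.
Qed.

Lemma card_goodC u v : #|good u v| = #|good v u|.
Proof.
pose f (e : G * G) := (e.2, e.1).
have injf : injective f by move=> [a b] [c d] [-> ->].
rewrite -(card_imset (good u v) injf); apply: eq_card => e.
apply/imsetP/idP => [[e' + ->]|]; first by rewrite !inE /= adj_sym => /and3P[-> -> ->].
rewrite inE => /and3P[ae h1 h2]; exists (f e); last by case: e ae h1 h2.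
by rewrite inE /= adj_sym ae h1 h2.
Qed.

Lemma excessC u v : excess u v = excess v u.
Proof. by rewrite /excess card_goodC distC. Qed.

(** The edges on geodesics from [u] to [v], oriented away from [u]. *)
Definition geo u v : {set G * G} :=
  [set e | adj e.1 e.2 & dist u e.1 + 1 + dist e.2 v == dist u v].

Definition nongeo u v : {set G * G} := good u v :\: geo u v.

Definition level u v i : {set G} :=
  [set a | (dist u a == i) && (dist u a + dist a v == dist u v)].

Definition geo_at u v i : {set G * G} := [set e in geo u v | dist u e.1 == i].

Lemma geo_sub_good u v : geo u v \subset good u v.
Proof.
apply/subsetP => -[a b]; rewrite !inE /= => /andP[ab /eqP E].
have := dist_tri b u v; have := dist_tri a u v; have := dist_step u ab.
have := dist_step v ab; rewrite ab (distC v b) (distC v a).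
have := dist_step v (etrans (adj_sym _ _) ab); rewrite (distC v a) (distC v b).
lia.
Qed.

Lemma card_geo_sum u v : #|geo u v| = \sum_(i < dist u v) #|geo_at u v i|.
Proof.
have [->|nuv] := eqVneq u v.
  rewrite dist0 big_ord0; apply/eqP; rewrite cards_eq0; apply/eqP/setP => e.
  by rewrite !inE dist0; lia.
have d_gt0 : 0 < dist u v by rewrite lt0n dist_eq0.
rewrite -sum1_card.
(* [insubd] needs a default in ['I_(dist u v)], hence the separate case [u = v]. Geodesic edges
   start below [dist u v], so the default is never taken on them. *)
pose h (e : G * G) : 'I_(dist u v) := insubd (Ordinal d_gt0) (dist u e.1).
rewrite (partition_big h predT) //=; apply: eq_bigr => i _.
rewrite -sum1_card; apply: eq_bigl => e; rewrite [RHS]inE; case ge: (e \in geo u v) => //=.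
have lt_e : dist u e.1 < dist u v by move: ge; rewrite inE; lia.
by rewrite -(inj_eq val_inj) /h val_insubd lt_e.
Qed.

(** Each vertex of the upper level is the head of a geodesic edge; dually, in [card_geo_out], each
    vertex of the lower level is the tail of one. *)
Lemma card_geo_in u v i : i < dist u v -> #|level u v i.+1| <= #|geo_at u v i|.
Proof.
move=> lt_i; apply: leq_trans (leq_imset_card snd _); apply: subset_leq_card.
apply/subsetP => a; rewrite inE => /andP[/eqP da /eqP E].
have [z za dz] := dist_pred da.
by apply/imsetP; exists (z, a); rewrite // !inE /= za dz; lia.
Qed.

Lemma card_geo_out u v i : i < dist u v -> #|level u v i| <= #|geo_at u v i|.
Proof.
move=> lt_i; apply: leq_trans (leq_imset_card fst _); apply: subset_leq_card.
apply/subsetP => a; rewrite inE => /andP[/eqP da /eqP E].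
have [|z za dz] := @dist_pred v a (dist u v - i).-1; first by rewrite distC; lia.
apply/imsetP; exists (a, z); rewrite // !inE /= adj_sym za (distC z); lia.
Qed.

Lemma level_gt0 u v i : i <= dist u v -> 0 < #|level u v i|.
Proof.
move=> le_i; have [a da av] := dist_at le_i.
by apply/card_gt0P; exists a; rewrite inE da av; lia.
Qed.

Lemma dist_le_geo u v : dist u v <= #|geo u v|.
Proof.
rewrite card_geo_sum -[X in X <= _]card_ord -sum1_card; apply: leq_sum => i _.
exact: leq_trans (level_gt0 (ltnW (ltn_ord i))) (card_geo_out (ltn_ord i)).
Qed.

Lemma card_good u v : #|good u v| = #|geo u v| + #|nongeo u v|.
Proof.
by rewrite /nongeo -(cardsID (geo u v) (good u v)) (setIidPr (geo_sub_good u v)).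
Qed.

Lemma goodE u v : #|good u v| = dist u v + excess u v.
Proof. by rewrite /excess card_good; have := dist_le_geo u v; lia. Qed.

Lemma nongeo_le u v : #|nongeo u v| <= excess u v.
Proof. by have := dist_le_geo u v; rewrite /excess card_good; lia. Qed.

(** If an inner level has k vertices, at least k geodesic edges enter it and at least k leave it,
    where a single geodesic has one of each. So the geodesic edges contribute 2(k - 1) to the
    excess, and the other good edges come on top. *)
Lemma excess_level u v i : 0 < i < dist u v ->
  #|nongeo u v| + (#|level u v i|).*2 <= excess u v + 2.
Proof.
case: i => // i /andP[_ lt_i]; rewrite /excess card_good card_geo_sum.
move Ek: #|level u v i.+1| => k; have k_gt0 : 0 < k by rewrite -Ek level_gt0 //; lia.
move Es: (\sum_(j < _) #|geo_at u v j|) => s.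
suff : dist u v + k.*2 <= s + 2 by lia.
(* The surplus over one edge at the two steps next to the level, whose index is now [i.+1]. *)
pose g (j : nat) := if (j == i) || (j == i.+1) then k.-1 else 0.
have lo (j : 'I_(dist u v)) : 1 + g j <= #|geo_at u v j|.
  rewrite /g; case: eqP => [Ej|_] /=.
    by have := @card_geo_in u v j (ltn_ord j); rewrite {1}Ej Ek /=; lia.
  case: eqP => [Ej|_] /=.
    by have := @card_geo_out u v j (ltn_ord j); rewrite {1}Ej Ek /=; lia.
  exact: leq_trans (level_gt0 (ltnW (ltn_ord j))) (card_geo_out (ltn_ord j)).
have sum_g : \sum_(j < dist u v) g j = k.-1 + k.-1.
  have lt_i1 : i < dist u v by lia.
  rewrite (bigD1 (Ordinal lt_i1)) //= (bigD1 (Ordinal lt_i)) /=; last first.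
    by rewrite -val_eqE /=; lia.
  rewrite /g !eqxx orbT big1 => [|j /andP[n1 n2]]; first by rewrite /= addn0.
  by move: n1 n2; rewrite -!val_eqE /=; case: eqP; case: eqP.
have : \sum_(j < dist u v) (1 + g j) <= s by rewrite -Es; apply: leq_sum => j _; exact: lo.
rewrite big_split sum1_card card_ord /= sum_g; lia.
Qed.

(** The case analyses below rest on two criteria: one good edge off the geodesics yields 1, and by
    [excess_ge2] two vertices on one inner level yield 2. *)
Lemma excess_ge1 u v a b : adj a b -> dist u a < dist u b -> dist v b < dist v a ->
  dist u a + 1 + dist b v <> dist u v -> 0 < excess u v.
Proof.
move=> ab h1 h2 /eqP h3; apply: leq_trans (nongeo_le u v); apply/card_gt0P.
by exists (a, b); rewrite !inE /= ab h1 h2 (negPf h3).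
Qed.

Lemma excess_ge2 u v a b : a != b -> dist u a = dist u b -> 0 < dist u a ->
  0 < dist a v -> dist u a + dist a v = dist u v -> dist u b + dist b v = dist u v ->
  1 < excess u v.
Proof.
move=> nab ea a0 av Ea Eb.
have := @excess_level u v (dist u a); rewrite a0 /=.
suff : 1 < #|level u v (dist u a)| by move=> ? /(_ ltac:(lia)); lia.
apply/card_gt1P; exists a, b; split => //; rewrite inE; lia.
Qed.

(** Double counting: the edge [ab], oriented from [a] to [b], is good for exactly the pairs [(u, v)]
    with [u] nearer to [a] and [v] nearer to [b], and there are [closer a b * closer b a] of
    them. *)
Lemma szeged_double : (szeged G).*2 = \sum_(u : G) \sum_(v : G) #|good u v|.
Proof.
rewrite /szeged -(@sum_sym_half (@adj G) (fun a b => closer a b * closer b a)); first last.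
- by move=> a b; rewrite mulnC.
- exact: adj_irr.
- exact: adj_sym.
transitivity (\sum_(p : G * G) \sum_(e : G * G) (e \in good p.1 p.2)).
  rewrite exchange_big /= pair_big_dep /= big_mkcond /=; apply: eq_bigr => -[a b] _ /=.
  have -> : closer a b * closer b a = 
     \sum_(p : G * G) (dist p.1 a < dist p.1 b) * (dist p.2 b < dist p.2 a).
    rewrite -(pair_bigA _ (fun u v => (dist u a < dist u b) * (dist v b < dist v a))) /=.
    rewrite /closer -!sum1dep_card big_distrlr /= [LHS]big_mkcond /=.
    apply: eq_bigr => u _; rewrite [X in if _ then X else _]big_mkcond /=.
    case: ifP => _; last by rewrite big1 // => v _; rewrite mul0n.
    by apply: eq_bigr => v _; rewrite mul1n; case: ifP.
  case ab: (adj a b).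
    by apply: eq_bigr => p _; rewrite inE /= ab /=; do 2!case: (_ < _).
  by rewrite big1 // => p _; rewrite inE /= ab.
rewrite [RHS]pair_big /=; apply: eq_bigr => p _.
rewrite -sum1_card [RHS]big_mkcond /=; apply: eq_bigr => e _; by case: (_ \in _).
Qed.

Lemma wiener_double : (wiener G).*2 = \sum_(u : G) \sum_(v : G) dist u v.
Proof.
transitivity (\sum_(u : G) \sum_(v : G | u != v) dist u v).
  rewrite (@sum_sym_half (fun u v => u != v)); first last.
  - exact: distC.
  - by move=> u; rewrite eqxx.
  - by move=> u v; rewrite eq_sym.
  congr _.*2; apply: eq_bigr => u _; apply: eq_bigl => v.
  by case: (eqVneq u v) => [->|]; rewrite ?ltnn.
apply: eq_bigr => u _; rewrite big_mkcond /=; apply: eq_bigr => v _.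
by case: eqP => // ->; rewrite dist0.
Qed.

Lemma szeged_wiener : (szeged G).*2 = (wiener G).*2 + total_excess G.
Proof.
rewrite szeged_double wiener_double /total_excess -big_split /=.
by apply: eq_bigr => u _; rewrite -big_split /=; apply: eq_bigr => v _; exact: goodE.
Qed.

(** * Summing excesses over a growing set *)

(** A geodesic leaves [Y] along some edge. If few edges leave [Y], this becomes a distance formula,
    as in [gateB] and [gateA]. *)
Lemma dist_gate (Y : {set G}) y t : y \in Y -> t \notin Y ->
  exists p q, [/\ p \in Y, q \notin Y, adj p q &
                  dist y t = dist y p + 1 + dist q t].
Proof.
move Ek: (dist y t) => k; elim: k y Ek => [|k IH] y Ek yY tY.
  by move/eqP: Ek tY; rewrite dist_eq0 => /eqP <-; rewrite yY.
have [|z zy dz] := @dist_pred t y k; first by rewrite distC.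
have [zY|zY] := boolP (z \in Y); last first.
  by exists y, z; split=> //; rewrite ?dist0 1?adj_sym // -dz (distC z); lia.
have [|p [q [pY qY pq E]]] := IH z _ zY tY; first by rewrite distC.
exists p, q; split=> //; have := dist_step p zy.
have := dist_tri p y t; have := dist_tri q p t; rewrite (adj_dist1 pq) !(distC p); lia.
Qed.

Lemma excess_to_ge (S : {set G}) y (l : seq G) :
  uniq l -> {subset l <= S} -> \sum_(s <- l) excess y s <= excess_to S y.
Proof.
move=> ul lS; rewrite big_uniq //= /excess_to (big_setID [set s in l]) /=.
rewrite (setIidPr _); last by apply/subsetP => s; rewrite inE; exact: lS.
by rewrite -[X in X <= _]addn0 leq_add // leq_eqVlt; apply/orP; left;
   apply/eqP/eq_bigl => s; rewrite inE.
Qed.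

Lemma excess_to1 (S : {set G}) y a k :
  a \in S -> k <= excess y a -> k <= excess_to S y.
Proof.
move=> aS ka; apply: leq_trans (@excess_to_ge S y [:: a] _ _) => //.
  by rewrite big_seq1.
by move=> s; rewrite inE => /eqP->.
Qed.

Lemma excess_to2 (S : {set G}) y a b i j : a \in S -> b \in S -> a != b ->
  i <= excess y a -> j <= excess y b -> i + j <= excess_to S y.
Proof.
move=> aS bS nab ia jb; apply: leq_trans (@excess_to_ge S y [:: a; b] _ _).
- by rewrite big_cons big_seq1 leq_add.
- by rewrite /= inE nab.
by move=> s; rewrite !inE => /orP[]/eqP->.
Qed.

(** Uniqueness together with the reversed pairs means that the unordered pairs are distinct and off
    the diagonal, so each is counted twice on the right. *)
Lemma inner_excess_ge (S : {set G}) (l : seq (G * G)) :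
  uniq (l ++ [seq (p.2, p.1) | p <- l]) ->
  {in l, forall p, (p.1 \in S) && (p.2 \in S)} ->
  (\sum_(p <- l) excess p.1 p.2).*2 <= inner_excess S.
Proof.
move=> ul lS; rewrite /inner_excess /excess_to pair_big_dep /=.
have -> : (\sum_(p <- l) excess p.1 p.2).*2 =
    \sum_(p <- l ++ [seq (p.2, p.1) | p <- l]) excess p.1 p.2.
  by rewrite big_cat big_map /= -addnn; congr (_ + _); apply: eq_bigr => p _; exact: excessC.
rewrite big_uniq //= [X in _ <= X](bigID (mem (l ++ [seq (p.2, p.1) | p <- l]))) /=.
rewrite -[X in X <= _]addn0 leq_add // leq_eqVlt; apply/orP; left.
apply/eqP/eq_bigl => p; case pl: (p \in _); rewrite ?andbF // andbT; symmetry.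
move: pl; rewrite mem_cat => /orP[/lS //|/mapP[q /lS qS ->]] /=.
by rewrite andbC.
Qed.

(** Mixed pairs occur in both orders; pairs with both members outside [S] are dropped. *)
Lemma total_excess_split (S : {set G}) :
  inner_excess S + (\sum_(y in ~: S) excess_to S y).*2 <= total_excess G.
Proof.
have E (F : G -> nat) : \sum_u F u = \sum_(u in S) F u + \sum_(u in ~: S) F u.
  by rewrite (bigID (mem S)) /=; congr (_ + _); apply: eq_bigl => u; rewrite inE.
rewrite /total_excess E /inner_excess.
have -> : \sum_(u in S) \sum_v excess u v =
    \sum_(u in S) excess_to S u + \sum_(y in ~: S) excess_to S y.
  rewrite [X in _ = _ + X]exchange_big -big_split /=; apply: eq_bigr => u _.
  by rewrite E; congr (_ + _); apply: eq_bigr => y _; exact: excessC.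
rewrite -addnn addnA leq_add2l; apply: leq_sum => y _.
by rewrite E; exact: leq_addr.
Qed.

(** An excess of 2 with [S] is worth 4 in the ordered count. So 4n - 8 is reached once [k] plus
    twice the sum of the surpluses [f] is at least 4|S| - 8, which is 8 for a 4-cycle and 12 for a
    5-cycle. *)
Lemma growth_sum (S : {set G}) k (f : G -> nat) :
  k <= inner_excess S -> (forall y, y \notin S -> 2 + f y <= excess_to S y) ->
  k + 4 * (gorder G - #|S|) + 2 * (\sum_(y in ~: S) f y) <= total_excess G.
Proof.
move=> kS S2; apply: leq_trans (total_excess_split S).
have -> : gorder G - #|S| = #|~: S| by rewrite /gorder -(cardsC S); lia.
suff : 2 * #|~: S| + \sum_(y in ~: S) f y <= \sum_(y in ~: S) excess_to S y by lia.
rewrite -sum1_card big_distrr -big_split /=; apply: leq_sum => y.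
by rewrite inE; exact: S2.
Qed.

Lemma growth_extra (S : {set G}) k e y0 :
  k <= inner_excess S -> (forall y, y \notin S -> 2 <= excess_to S y) ->
  y0 \notin S -> 2 + e <= excess_to S y0 ->
  k + 4 * (gorder G - #|S|) + 2 * e <= total_excess G.
Proof.
move=> kS S2 y0S ey0.
have /(growth_sum kS) : forall y, y \notin S -> 2 + (y == y0) * e <= excess_to S y.
  by move=> y yS; case: eqP => [->|_]; rewrite ?mul1n ?mul0n // addn0 S2.
by rewrite (bigD1 y0) ?inE //= eqxx; lia.
Qed.

Lemma growth (S : {set G}) k :
  k <= inner_excess S -> (forall y, y \notin S -> 2 <= excess_to S y) ->
  k + 4 * (gorder G - #|S|) <= total_excess G.
Proof.
move=> kS S2; case: (set_0Vmem (~: S)) => [S0|[y0 y0S]]; last first.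
  rewrite inE in y0S; have := @growth_extra S k 0 y0 kS S2 y0S.
  by rewrite addn0 muln0 addn0 => -> //; exact: S2.
apply: leq_trans (total_excess_split S); rewrite S0 big_set0.
by rewrite /gorder -(cardsC S) S0 cards0 addn0 subnn muln0; lia.
Qed.

Hypothesis conn2 : k_connected 2 G.

(** The working form of 2-connectedness: after deletion of [q] some edge still leaves [X]. *)
Lemma exit_avoiding q (X : {set G}) u v : u \in X -> v \notin X ->
  u != q -> v != q ->
  exists a b, [/\ a \in X, b \notin X, a != q, b != q & adj a b].
Proof.
move=> uX vX uq vq; have [_ /(_ [set q])] := conn2; rewrite cards1 => /(_ isT).
move=> /(_ u v); rewrite !inE => /(_ uq vq) uv.
have [a [b [aX bX]]] := connect_exit uv uX vX.
by rewrite /= !inE => /andP[/andP[aq bq] ab]; exists a, b.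
Qed.


(** * A vertex whose only non-neighbour has degree two *)

Lemma dist_common u v w : u != v -> ~~ adj u v -> adj w u -> adj w v -> dist u v = 2.
Proof.
move=> nuv /(nadj_dist nuv) d2 /adj_dist1 wu /adj_dist1 wv.
by have := dist_tri w u v; rewrite (distC u w); dlia distC.
Qed.

(** [S] is the 4-cycle [x w1 v w2]. Without the chord [w1 w2] both diagonals have excess 2, which
    gives the 8 that [growth] needs. With the chord only 4 is left, and a surplus of 2 outside [S]
    is drawn from non-neighbours of [w1] and of [w2], which exist because no vertex is
    dominating. *)
Lemma total_deg2_nonneighbor x v w1 w2 :
  (forall y, y != x -> y != v -> adj x y) -> x != v -> ~~ adj x v -> w1 != w2 ->
  (forall y, adj v y = (y == w1) || (y == w2)) ->
  (forall w, exists2 y, y != w & ~~ adj w y) ->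
  4 * gorder G <= total_excess G + 8.
Proof.
move=> xadj nxv xv nw vadj nodom.
have vw1 : adj v w1 by rewrite vadj eqxx.
have vw2 : adj v w2 by rewrite vadj eqxx orbT.
have w1v : w1 != v by rewrite eq_sym adj_neq.
have w2v : w2 != v by rewrite eq_sym adj_neq.
have w1x : w1 != x by apply: contraNneq xv => <-; rewrite adj_sym.
have w2x : w2 != x by apply: contraNneq xv => <-; rewrite adj_sym.
have [dxw1 dxw2] : dist x w1 = 1 /\ dist x w2 = 1 by split; apply/adj_dist1/xadj.
have [dvw1 dvw2] : dist v w1 = 1 /\ dist v w2 = 1 by split; apply: adj_dist1.
have dxv : dist x v = 2 by apply: (@dist_common _ _ w1); rewrite // adj_sym // xadj.
have exv : 1 < excess x v by apply: (@excess_ge2 _ _ w1 w2) => //; dlia distC.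
pose S := [set s in [:: x; v; w1; w2]].
have [xS vS w1S w2S] : [/\ x \in S, v \in S, w1 \in S & w2 \in S].
  by rewrite !inE !eqxx !orbT.
have cardS : #|S| = 4 by rewrite cardsE; apply/card_uniqP; neqs.
have outS y : y \notin S -> [/\ y != x, y != v, y != w1 & y != w2].
  by rewrite !inE !negb_or => /and4P.
have dyx y : y \notin S -> dist x y = 1.
  by move=> /outS[yx yv _ _]; apply/adj_dist1/xadj.
have dyw y w : y \notin S -> adj v w -> 0 < dist y w <= 2.
  move=> yS vw; have := dyx y yS; have := dist_tri x y w; rewrite (distC y x) lt0n dist_eq0.
  have [_ _ y1 y2] := outS y yS; move: vw; rewrite vadj => /orP[]/eqP->.
    by rewrite y1; dlia distC.
  by rewrite y2; dlia distC.
have dyv y : y \notin S -> dist y v = (minn (dist y w1) (dist y w2)).+1.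
  move=> yS; have [yx yv y1 y2] := outS y yS.
  have := dist_step y (etrans (adj_sym _ _) vw1); have := dist_step y (etrans (adj_sym _ _) vw2).
  have : 0 < dist y v by rewrite lt0n dist_eq0.
  move Ek : (dist y v) => [|k] // _; have [z + dz] := dist_pred Ek.
  by rewrite adj_sym vadj => /orP[]/eqP E; rewrite E in dz; dlia distC.

(* Here [y] is adjacent to [a] and at distance 2 from [b]. For the pair [[y, v]] the edge [xb] is
   off the geodesics. For [[y, b]] the chord makes [a] a second middle vertex besides [x]; without
   it [av] is off the geodesics. *)
have near a b y : adj v a -> adj v b -> a != b -> adj x a -> adj x b -> y \notin S ->
    dist y a < dist y b ->
    1 <= excess y v /\ (if adj a b then 2 else 1) <= excess y b.
  move=> va vb ab xa xb yS lt_ab; have := dyw y a yS va; have := dyw y b yS vb.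
  have := dyx y yS; have := dyv y yS => hv hx hb ha.
  have dyv2 : dist y v = 2.
    move: va vb; rewrite !vadj => /orP[]/eqP Ea /orP[]/eqP Eb;
      rewrite Ea in ha lt_ab; rewrite Eb in hb lt_ab; dlia distC.
  have := (adj_dist1 va, adj_dist1 vb, adj_dist1 xa, adj_dist1 xb) => -[[[dva dvb] dxa] dxb].
  split; first by apply: (@excess_ge1 _ _ x b) => //; dlia distC.
  case: ifP => [/adj_dist1 dab|/negbT /(nadj_dist ab) dab].
    apply: (@excess_ge2 _ _ x a); try dlia distC.
    by apply: contraTneq xa => <-; rewrite adj_irr.
  by apply: (@excess_ge1 _ _ a v); rewrite 1?adj_sym //; dlia distC.
have xw1 : adj x w1 by rewrite -dist_eq1 dxw1.
have xw2 : adj x w2 by rewrite -dist_eq1 dxw2.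
have equi y : y \notin S -> dist y w1 = dist y w2 -> 2 <= excess y v.
  move=> yS E12; have := dyv y yS; have := dyw y w1 yS vw1.
  by move=> h1 h2; apply: (@excess_ge2 _ _ w1 w2) => //; dlia distC.
have near1 y : y \notin S -> dist y w1 < dist y w2 -> 2 + adj w1 w2 <= excess_to S y.
  move=> yS /(near w1 w2 y vw1 vw2 nw xw1 xw2 yS)[h1 h2].
  have := excess_to2 vS w2S _ h1 h2; rewrite eq_sym w2v => /(_ isT).
  by case: (adj w1 w2).
have near2 y : y \notin S -> dist y w2 < dist y w1 -> 2 + adj w1 w2 <= excess_to S y.
  rewrite eq_sym in nw; move=> yS /(near w2 w1 y vw2 vw1 nw xw2 xw1 yS)[h1 h2].
  have := excess_to2 vS w1S _ h1 h2; rewrite eq_sym w1v (adj_sym w2) => /(_ isT).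
  by case: (adj w1 w2).
have S2 y : y \notin S -> 2 <= excess_to S y.
  move=> yS; have [lt12|lt21|E12] := ltngtP (dist y w1) (dist y w2).
  - by apply: leq_trans (near1 y yS lt12).
  - by apply: leq_trans (near2 y yS lt21).
  exact: excess_to1 vS (equi y yS E12).
have leG : 4 <= gorder G by rewrite -cardS max_card.
have [chord|nchord] := boolP (adj w1 w2); last first.
  have d12 := dist_common nw nchord xw1 xw2.
  have ew : 1 < excess w1 w2 by apply: (@excess_ge2 _ _ x v) => //; dlia distC.
  have := @inner_excess_ge S [:: (x, v); (w1, w2)].
  rewrite /= !big_cons big_nil /= => base.
  have {}base : 8 <= inner_excess S.
    apply: leq_trans (base _ _); first by dlia distC.
      by rewrite !inE /= !xpair_eqE; neq_rw.
    by move=> p; rewrite !inE => /orP[]/eqP->; rewrite /= !eqxx ?orbT.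
  by have := growth base S2; rewrite cardS; dlia distC.
have base : 4 <= inner_excess S.
  have := @inner_excess_ge S [:: (x, v)].
  rewrite /= !big_cons big_nil /= => base; apply: leq_trans (base _ _); first by dlia distC.
    by rewrite !inE xpair_eqE (negPf nxv).
  by move=> p; rewrite !inE => /eqP->; rewrite /= !eqxx ?orbT.
rewrite chord in near1 near2.
have fin1 s : s \notin S -> 4 <= excess_to S s -> 4 * gorder G <= total_excess G + 8.
  by move=> sS /(@growth_extra S 4 2 s base S2 sS); rewrite cardS; dlia distC.
(* Both [x] and [r] are midway between [s] and [t], so [s] has excess 2 with [t] as well as with
   [v]. *)
have fin2 s r : s \notin S -> dist s w1 = dist s w2 -> adj s r -> r != x ->
    (exists2 t, t \in S & [/\ t != v, adj t x, 1 < dist s t & adj r t]) ->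
    4 * gorder G <= total_excess G + 8.
  move=> sS E12 sr rx [t tS [tv tx st rt]]; apply: (fin1 s) => //.
  have dst : dist s t = 2.
    have := dist_tri r s t; rewrite (adj_dist1 sr) (adj_dist1 rt); dlia distC.
  apply: (excess_to2 vS tS _ (equi _ sS E12)); first by rewrite eq_sym.
  have := dyx s sS; have := adj_dist1 tx; have := adj_dist1 sr; have := adj_dist1 rt.
  by move=> *; apply: (@excess_ge2 _ _ r x); rewrite // 1?eq_sym //; dlia distC.
have w1x' : adj w1 x by rewrite adj_sym.
have w2x' : adj w2 x by rewrite adj_sym.
have miss w : adj v w -> exists2 s, s \notin S & 1 < dist s w.
  move=> vw; have [s sw nws] := nodom w.
  exists s; last by rewrite (distC s) nadj_dist // eq_sym.
  apply: contra nws => sS; move: vw sS sw; rewrite vadj => /orP[]/eqP->;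
    rewrite !inE => /or4P[]/eqP-> => //; rewrite ?eqxx // => _;
    by rewrite // adj_sym.
have [s1 s1S d1] := miss _ vw1; have [s2 s2S d2] := miss _ vw2.
have [/existsP[s /and3P[sS f1 f2]]|none] :=
    boolP [exists s, [&& s \notin S, 1 < dist s w1 & 1 < dist s w2]].
  (* An edge leaving [X] and avoiding [x] ends in a neighbour of [w1] or [w2], as [fin2] demands. *)
  pose X := [set t | [&& t \notin S, 1 < dist t w1 & 1 < dist t w2]].
  have [||||a [r [aX rX ax rx ar]]] := @exit_avoiding x X s w1.
  - by rewrite inE sS f1.
  - by rewrite inE w1S.
  - by have [] := outS s sS.
  - by [].
  move: aX; rewrite inE => /and3P[aS a1 a2].
  have da1 := dyw _ _ aS vw1; have da2 := dyw _ _ aS vw2.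
  have rS : r \notin S.
    rewrite !inE !negb_or rx /=; apply/and3P; split; apply: contraTneq ar => ->.
    - rewrite adj_sym vadj; have [_ _ aw1 aw2] := outS a aS.
      by rewrite negb_or aw1 aw2.
    - by rewrite -dist_eq1; dlia distC.
    by rewrite -dist_eq1; dlia distC.
  apply: (fin2 a r) => //; first by dlia distC.
  move: rX; rewrite inE rS /= negb_and => /orP[] rw.
  - exists w1 => //; split=> //; rewrite -dist_eq1; have := dyw _ _ rS vw1; dlia distC.
  exists w2 => //; split=> //; rewrite -dist_eq1; have := dyw _ _ rS vw2; dlia distC.
have {}none s : s \notin S -> ~~ ((1 < dist s w1) && (1 < dist s w2)).
  by move=> sS; apply: contra none => h; apply/existsP; exists s; rewrite sS.
have := none _ s1S; have := none _ s2S.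
have := dyw _ _ s1S vw1; have := dyw _ _ s1S vw2; have := dyw _ _ s2S vw1; have := dyw _ _ s2S vw2.
move=> h1 h2 h3 h4 h5 h6.
have s12 : s1 != s2 by apply/eqP => E; rewrite -E in d2; dlia distC.
(* Now [s1] is adjacent to [w2] and [s2] to [w1], so each has a surplus of 1 by [near2] and
   [near1]. *)
pose f y : nat := (y == s1) + (y == s2).
have Sf y : y \notin S -> 2 + f y <= excess_to S y.
  move=> yS; rewrite /f; case: eqP => [->|_].
    by rewrite (negPf s12) near2 //; dlia distC.
  by case: eqP => [->|_]; rewrite ?near1 ?S2 //; dlia distC.
have f2 : 2 <= \sum_(y in ~: S) f y.
  have s2' : (s2 \in ~: S) && (s2 != s1) by rewrite inE s2S eq_sym.
  rewrite (bigD1 s1) /=; last by rewrite inE.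
  rewrite (bigD1 s2) /=; last by rewrite s2'.
  rewrite {1 2}/f !eqxx; move: (\sum_(_ | _) _) => r; clear; lia.
have := growth_sum base Sf; rewrite cardS; move: f2; dlia distC.
Qed.


(** * Pentagons *)

Section Pent.
Variables (x w w' b z : G) (B B' : {set G}).
Hypothesis P : pentagon x w w' b z B B'.

Let S : {set G} := pentagon_set x w w' b z.

Lemma pent_farE y : y \in B \/ y \in B' -> y != x /\ ~~ adj x y.
Proof. by move/orP; rewrite (pent_far P) => /andP. Qed.

Lemma pent_distinct :
  [/\ x != b, x != z, w != b, w != z & w' != b] /\
  [/\ w' != z, b != z, x != w, x != w' & w != w'].
Proof.
have [bx nxb] := pent_farE (or_introl (pent_bB P)).
have [zx nxz] := pent_farE (or_intror (pent_zB' P)).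
have ne v : adj x v -> v != b /\ v != z.
  by move=> xv; split; apply: contraTneq xv => ->.
have [wb wz] := ne _ (pent_xw P); have [wb' wz'] := ne _ (pent_xw' P).
have := (adj_neq (pent_bz P), adj_neq (pent_xw P), adj_neq (pent_xw' P), pent_ww' P).
by case=> [[[? ?] ?] ?]; split; split=> //; rewrite eq_sym.
Qed.

Lemma pent_nbw' : ~~ adj b w'.
Proof.
have [[_ _ _ _ _] [wz' _ _ _ ww']] := pent_distinct.
apply/negP => /(pent_B P (pent_bB P)) /or3P[w'B|/eqP E|/andP[_ /eqP E]].
- by have [_ /negP[]] := pent_farE (or_introl w'B); exact: pent_xw' P.
- by rewrite E eqxx in ww'.
by rewrite E eqxx in wz'.
Qed.

(** Three diagonals of the 5-cycle are nonedges. Only [zw] and [ww'] can be chords, so these two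
    distances stay open. *)
Lemma pent_dists :
  [/\ dist x w = 1, dist x w' = 1, dist w b = 1, dist w' z = 1 & dist b z = 1] /\
  [/\ dist x b = 2, dist x z = 2, dist b w' = 2, 0 < dist z w <= 2
    & 0 < dist w w' <= 2].
Proof.
have [[xb xz wb wz wb'] [wz' bz xw xw' ww']] := pent_distinct.
have [bx nxb] := pent_farE (or_introl (pent_bB P)).
have [zx nxz] := pent_farE (or_intror (pent_zB' P)).
have dxw := adj_dist1 (pent_xw P); have dxw' := adj_dist1 (pent_xw' P).
have dwb := adj_dist1 (pent_wb P); have dwz := adj_dist1 (pent_w'z P).
have dbz := adj_dist1 (pent_bz P).
have dxb := nadj_dist xb nxb; have dxz := nadj_dist xz nxz.
have dbw' : 1 < dist b w' by apply: nadj_dist pent_nbw'; rewrite eq_sym.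
have t1 := dist_tri w x b; have t2 := dist_tri w' x z; have t3 := dist_tri z b w'.
have t4 := dist_tri b z w; have t5 := dist_tri x w w'.
move: ww' wz; rewrite -!dist_eq0 => ww' wz.
by split; split=> //; dlia distC.
Qed.

(** The two terms of the minimum are the two ways out of [B]: to [w], or along [bz]. *)
Lemma gateB y t : y \in B -> t \notin B ->
  dist y t = minn (dist y w + dist w t) (dist y b + 1 + dist z t).
Proof.
move=> yB tB; have [p [q [pB qB pq E]]] := dist_gate yB tB.
have t1 := dist_tri w y t; have t2 := dist_tri b y t; have t3 := dist_tri z b t.
have dbz := adj_dist1 (pent_bz P).
case/or3P: (pent_B P pB pq) => [qB'|/eqP Eq|/andP[/eqP Ep /eqP Eq]].
- by rewrite qB' in qB.
- by have := dist_step y pq; rewrite Eq in E *; dlia distC.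
by rewrite Eq Ep in E; dlia distC.
Qed.

(** By [pent_far] these are [x] and its neighbours other than [w] and [w']. *)
Definition near_side : {set G} := ~: (B :|: B' :|: [set w; w']).

Lemma near_sideP y :
  reflect [/\ y \notin B, y \notin B', y != w & y != w'] (y \in near_side).
Proof. by rewrite !inE !negb_or -!andbA; apply: and4P. Qed.

Lemma near_adjx y : y \in near_side -> y != x -> adj x y.
Proof.
move=> /near_sideP[yB yB' _ _] yx; have := pent_far P y.
by rewrite (negPf yB) (negPf yB') yx => /esym/negbT; rewrite negbK.
Qed.

Lemma near_exit y q : y \in near_side -> q \notin near_side -> adj y q ->
  q = w \/ q = w'.
Proof.
move=> yA; rewrite inE negbK => qA yq.
have [yB yB' yw yw'] := near_sideP _ yA.
move: qA; rewrite inE => /orP[|]; last first.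
  by rewrite !inE => /orP[]/eqP; [left | right].
rewrite adj_sym in yq; rewrite inE => /orP[qB|qB'].
  case/or3P: (pent_B P qB yq) => [yB0|/eqP E|/andP[_ /eqP E]].
  - by rewrite yB0 in yB.
  - by rewrite E eqxx in yw.
  by rewrite E (pent_zB' P) in yB'.
case/or4P: (pent_B' P qB' yq) => [yB0|/eqP E|/andP[_ /eqP E]|/and3P[_ /eqP E _]].
- by rewrite yB0 in yB'.
- by rewrite E eqxx in yw'.
- by rewrite E (pent_bB P) in yB.
by rewrite E eqxx in yw.
Qed.

Lemma gateA y t : y \in near_side -> t \notin near_side ->
  dist y t = minn (dist y w + dist w t) (dist y w' + dist w' t).
Proof.
move=> yA tA; have [p [q [pA qA pq E]]] := dist_gate yA tA.
have t1 := dist_tri w y t; have t2 := dist_tri w' y t.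
by case: (near_exit pA qA pq) => Eq; have := dist_step y pq; rewrite Eq in E *;
  dlia distC.
Qed.

Lemma pent_inS : [/\ x \in S, w \in S, w' \in S, b \in S & z \in S].
Proof. by rewrite /S !inE !eqxx !orbT. Qed.

Lemma near_dists y : y \in near_side -> y != x ->
  [/\ dist y x = 1, 0 < dist y w <= 2, 0 < dist y w' <= 2,
      dist y b = minn (dist y w + 1) (dist y w' + 2) &
      dist y z = minn (dist y w + dist w z) (dist y w' + 1)].
Proof.
move=> yA yx; have [[dxw dxw' dwb dwz dbz] [dxb dxz dbw' dzw dww']] := pent_dists.
have dyx := adj_dist1 (near_adjx yA yx).
have [yB yB' yw yw'] := near_sideP _ yA.
have gb := @gateA y b yA; have gz := @gateA y z yA.
rewrite !inE negbK (pent_bB P) in gb; rewrite !inE negbK (pent_zB' P) orbT in gz.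
have t1 := dist_tri x y w; have t2 := dist_tri x y w'.
rewrite -!dist_eq0 in yw yw'.
have {}gb := gb isT; have {}gz := gz isT.
by split; dlia distC.
Qed.

(** The distances from [y] to the cycle are determined by those to [w] and [w'], so it suffices to
    compare these two. The set [T] is left open because the bound serves both for the 5-cycle and,
    in [gem_growth], for the complement of the near side, which does not contain [x]. *)
Lemma near_excess (T : {set G}) y : w' \in T -> b \in T -> z \in T ->
  y \in near_side -> y != x -> 2 <= excess_to T y.
Proof.
move=> w'S bS zS yA yx; have [[dxw dxw' dwb dwz dbz] [dxb dxz dbw' dzw dww']] := pent_dists.
have [[xb xz wb wz wb'] [wz' nbz xw xw' ww']] := pent_distinct.
have [dyx yw yw' yb yz] := near_dists yA yx.
have [zw1|zw2] : dist z w = 1 \/ dist z w = 2 by dlia distC.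
  have [lt|gt|E] := ltngtP (dist y w) (dist y w').
  - have e1 : 1 <= excess y z.
      by apply: (@excess_ge1 _ _ x w'); [exact: pent_xw' P | dlia distC..].
    have e2 : 1 <= excess y w'.
      have [ww1|ww2] : dist w w' = 1 \/ dist w w' = 2 by dlia distC.
        by apply: ltnW; apply: (@excess_ge2 _ _ x w) => //; dlia distC.
      by apply: (@excess_ge1 _ _ w z); [rewrite -dist_eq1; dlia distC | dlia distC..].
    by apply: leq_trans (excess_to2 zS w'S _ e1 e2); rewrite // eq_sym.
  - apply: (excess_to1 bS); apply: (@excess_ge2 _ _ w z) => //; dlia distC.
  by apply: (excess_to1 zS); apply: (@excess_ge2 _ _ w w') => //; dlia distC.
have [lt|gt|E] := ltngtP (dist y w) (dist y w').
- by apply: (excess_to1 zS); apply: (@excess_ge2 _ _ w' b) => //; dlia distC.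
- by apply: (excess_to1 bS); apply: (@excess_ge2 _ _ w z) => //; dlia distC.
have e1 : 1 <= excess y b.
  by apply: (@excess_ge1 _ _ w' z); [exact: pent_w'z P | dlia distC..].
have e2 : 1 <= excess y z.
  by apply: (@excess_ge1 _ _ w b); [exact: pent_wb P | dlia distC..].
exact: leq_trans (excess_to2 bS zS nbz e1 e2).
Qed.

Lemma far_dists y : y \in B -> y != b ->
  [/\ 0 < dist y w, 0 < dist y b, dist y b <= (dist y w).+1,
      dist y w <= (dist y b).+1 & dist y x = dist y w + 1] /\
  (dist y w' = minn (dist y w + dist w w') (dist y b + 2) /\
   dist y z = minn (dist y w + dist w z) (dist y b + 1)).
Proof.
move=> yB yb; have [[dxw dxw' dwb dwz dbz] [dxb dxz dbw' dzw dww']] := pent_dists.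
have notB t : adj x t || (t == x) -> t \notin B.
  move=> xt; apply/negP => tB; have [tx nxt] := pent_farE (or_introl tB).
  by move: xt; rewrite (negPf nxt) (negPf tx).
have zB : z \notin B by apply/negP => /(pent_disj P); rewrite (pent_zB' P).
have gx := gateB yB (notB x _); have gw' := gateB yB (notB w' _).
have {}gx := gx ltac:(by rewrite eqxx orbT).
have {}gw' := gw' ltac:(by rewrite (pent_xw' P)).
have gz := gateB yB zB; rewrite dist0 in gz.
have := notB w; rewrite (pent_xw P) => /(_ isT) wB.
have yw : y != w by apply: contraNneq wB => <-.
rewrite -!dist_eq0 in yb yw.
have t1 := dist_tri w y b; have t2 := dist_tri b y w.
by split; split; dlia distC.
Qed.

(** The distances from [y] to the cycle are determined by those to [w] and [b]. In the excluded case
    [w] is adjacent to the rest of the cycle, and when [y] is nearer to [w] than to [b] no excess is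
    forced. *)
Lemma far_excess y : y \in B -> y != b ->
  ~~ [&& adj z w, adj w w' & dist y w < dist y b] -> 2 <= excess_to S y.
Proof.
move=> yB yb ngem; have [[dxw dxw' dwb dwz dbz] [dxb dxz dbw' dzw dww']] := pent_dists.
have [[xb xz wb wz wb'] [wz' nbz xw xw' ww']] := pent_distinct.
have [xS wS w'S bS zS] := pent_inS.
have [[yw0 yb0 ybw ywb dyx] [dyw' dyz]] := far_dists yB yb.
rewrite -!dist_eq1 in ngem.
have [ww1|ww2] : dist w w' = 1 \/ dist w w' = 2 by dlia distC.
  have [zw1|zw2] : dist z w = 1 \/ dist z w = 2 by dlia distC.
    have [lt|gt|E] := ltngtP (dist y w) (dist y b).
    - by move: ngem; rewrite zw1 ww1 lt.
    - by apply: (excess_to1 w'S); apply: (@excess_ge2 _ _ w z) => //; dlia distC.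
    by apply: (excess_to1 zS); apply: (@excess_ge2 _ _ w b) => //; dlia distC.
  have [lt|gt|E] := ltngtP (dist y w) (dist y b).
  - by apply: (excess_to1 zS); apply: (@excess_ge2 _ _ b w') => //; rewrite 1?eq_sym //; dlia distC.
  - by apply: (excess_to1 w'S); apply: (@excess_ge2 _ _ w z) => //; dlia distC.
  have e1 : 1 <= excess y w'.
    by apply: (@excess_ge1 _ _ b z); [exact: pent_bz P | dlia distC..].
  have e2 : 1 <= excess y z.
    by apply: (@excess_ge1 _ _ w w'); [rewrite -dist_eq1; dlia distC | dlia distC..].
  exact: leq_trans (excess_to2 w'S zS wz' e1 e2).
have [lt|gt|E] := ltngtP (dist y w) (dist y b).
- have [zw1|zw2] : dist z w = 1 \/ dist z w = 2 by dlia distC.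
    by apply: (excess_to1 w'S); apply: (@excess_ge2 _ _ x z) => //; dlia distC.
  have e1 : 1 <= excess y w'.
    by apply: (@excess_ge1 _ _ b z); [exact: pent_bz P | dlia distC..].
  have e2 : 1 <= excess y z.
    by apply: (@excess_ge1 _ _ x w'); [exact: pent_xw' P | dlia distC..].
  exact: leq_trans (excess_to2 w'S zS wz' e1 e2).
- have e1 : 1 <= excess y w'.
    by apply: (@excess_ge1 _ _ w x); [rewrite adj_sym; exact: pent_xw P | dlia distC..].
  have e2 : 1 <= excess y x.
    by apply: (@excess_ge1 _ _ z w'); [rewrite adj_sym; exact: pent_w'z P | dlia distC..].
  by apply: leq_trans (excess_to2 w'S xS _ e1 e2); rewrite // eq_sym.
have [zw1|zw2] : dist z w = 1 \/ dist z w = 2 by dlia distC.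
  by apply: (excess_to1 zS); apply: (@excess_ge2 _ _ w b) => //; dlia distC.
by apply: (excess_to1 w'S); apply: (@excess_ge2 _ _ x z) => //; dlia distC.
Qed.

Lemma pent_outS y : y \notin S ->
  [\/ y \in near_side /\ y != x, y \in B /\ y != b | y \in B' /\ y != z].
Proof.
rewrite /S !inE !negb_or => /and5P[yx yw yw' yb yz].
have [yB|yB] := boolP (y \in B); first by apply: Or32.
have [yB'|yB'] := boolP (y \in B'); first by apply: Or33.
by apply: Or31; split=> //; rewrite yw yw'.
Qed.

Lemma card_pentS : #|S| = 5.
Proof.
have [[xb xz wb wz wb'] [wz' nbz xw xw' ww']] := pent_distinct.
by rewrite /S cardsE; apply/card_uniqP; neqs.
Qed.

Lemma adj_zw_B' : adj z w -> B' = [set z].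
Proof.
have [[_ _ _ wz _] [_ _ _ _ ww']] := pent_distinct.
move=> zw; case/or4P: (pent_B' P (pent_zB' P) zw) => [wB'|/eqP E|/andP[_ /eqP E]|/and3P[_ _ /eqP //]].
- by have [_ /negP[]] := pent_farE (or_intror wB'); exact: pent_xw P.
- by rewrite E eqxx in ww'.
by have [_ /negP[]] := pent_farE (or_introl (pent_bB P)); rewrite -E; exact: pent_xw P.
Qed.

End Pent.

(** * The bound for a pentagon, by its chords *)

Section Pent.
Variables (x w w' b z : G) (B B' : {set G}).
Hypothesis P : pentagon x w w' b z B B'.
Let S : {set G} := pentagon_set x w w' b z.

(* The one position of [y] in which the pairs formed by [y] and a vertex of the
   5-cycle need not have any excess. *)
Definition gem_obstruction y :=
  [&& y \in B, y != b, adj z w, adj w w' & dist y w < dist y b].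

(** For [y] in [B'] the two sides are exchanged: the chord [zw] would make [B'] the singleton of
    [z], and without it [pentagon_swap] applies. *)
Lemma pent_growth y : y \notin S -> ~~ gem_obstruction y -> 2 <= excess_to S y.
Proof.
move=> yS ngem; case: (pent_outS B B' yS) => [[yA yx]|[yB yb]|[yB' yz]].
- by have [xS wS w'S bS zS] := pent_inS x w w' b z; apply: (near_excess P).
- by apply: (far_excess P) => //; move: ngem; rewrite /gem_obstruction yB yb.
have [zw|zw] := boolP (adj z w).
  by move: yB' yz; rewrite (adj_zw_B' P zw) inE => /eqP->; rewrite eqxx.
have P' := pentagon_swap P zw; rewrite /S pentagon_set_swap.
by apply: (far_excess P') => //; rewrite (negPf (pent_nbw' P)).
Qed.

Lemma pent_inner (l : seq (G * G)) :
  uniq (l ++ [seq (p.2, p.1) | p <- l]) ->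
  all (fun p => (p.1 \in S) && (p.2 \in S)) l ->
  (\sum_(p <- l) excess p.1 p.2).*2 <= inner_excess S.
Proof. by move=> ul /allP lS; apply: inner_excess_ge. Qed.

(** For five vertices [growth] needs 4 * 5 - 8 = 12. In [pent_total_extra] an inner excess of 10 is
    completed by one outside vertex with surplus 1. *)
Lemma pent_total_base : 12 <= inner_excess S ->
  (forall y, ~~ gem_obstruction y) -> 4 * gorder G <= total_excess G + 8.
Proof.
move=> base ngem; have := growth base (fun y yS => pent_growth yS (ngem y)).
have : 5 <= gorder G by rewrite -(card_pentS P) max_card.
by rewrite (card_pentS P); dlia distC.
Qed.

Lemma pent_total_extra y : 10 <= inner_excess S ->
  (forall y, ~~ gem_obstruction y) -> y \notin S -> 3 <= excess_to S y ->
  4 * gorder G <= total_excess G + 8.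
Proof.
move=> base ngem yS ey.
have := @growth_extra S 10 1 y base (fun y yS => pent_growth yS (ngem y)) yS ey.
have : 5 <= gorder G by rewrite -(card_pentS P) max_card.
by rewrite (card_pentS P); dlia distC.
Qed.

Ltac pent_pairs l :=
  let base := fresh in
  have base := @pent_inner l; rewrite /= !big_cons big_nil /= in base;
  apply: leq_trans (base _ _);
  [dlia distC
  |rewrite !inE /= ?xpair_eqE; neq_rw; by []
  |by rewrite /= /S !inE !eqxx ?orbT].

(** With exactly one chord the four nonadjacent pairs of the cycle have excesses at least 2, 2, 1,
    1, which doubles to 12. *)
Lemma pent_house : adj z w != adj w w' -> 4 * gorder G <= total_excess G + 8.
Proof.
have [[dxw dxw' dwb dwz dbz] [dxb dxz dbw' dzw dww']] := pent_dists P.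
have [[xb xz wb wz wb'] [wz' nbz xw xw' ww']] := pent_distinct P.
have [bz [axw' [w'z wb_]]] := (pent_bz P, (pent_xw' P, (pent_w'z P, pent_wb P))).
rewrite -!dist_eq1 => zw_ww'.
apply: pent_total_base => [|y]; last first.
  by apply: contraNN zw_ww' => /and5P[_ _]; rewrite -!dist_eq1 => -> ->.
have [ww1|ww2] : dist w w' = 1 \/ dist w w' = 2 by dlia distC.
  have e1 : 2 <= excess b w' by apply: (@excess_ge2 _ _ w z) => //; dlia distC.
  have e2 : 2 <= excess z w by apply: (@excess_ge2 _ _ b w') => //; rewrite 1?eq_sym //; dlia distC.
  have e3 : 1 <= excess x b by apply: (@excess_ge1 _ _ w' z) => //; dlia distC.
  have e4 : 1 <= excess x z by apply: (@excess_ge1 _ _ w b) => //; dlia distC.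
  pent_pairs [:: (b, w'); (z, w); (x, b); (x, z)].
have e1 : 2 <= excess x z by apply: (@excess_ge2 _ _ w w') => //; dlia distC.
have e2 : 2 <= excess w w' by apply: (@excess_ge2 _ _ x z) => //; dlia distC.
have e3 : 1 <= excess x b by apply: (@excess_ge1 _ _ w' z) => //; dlia distC.
have axw := pent_xw P.
have e4 : 1 <= excess b w' by apply: (@excess_ge1 _ _ w x); rewrite 1?adj_sym //; dlia distC.
pent_pairs [:: (x, z); (w, w'); (x, b); (b, w')].
Qed.

Lemma pentS_notin y : (y \in near_side w w' B B' /\ y != x) \/ (y \in B /\ y != b) ->
  y \notin S.
Proof.
have [[xb xz wb wz wb'] [wz' nbz xw xw' ww']] := pent_distinct P.
have notB t : adj x t || (t == x) -> t \notin B.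
  move=> xt; apply/negP => tB; have [tx nxt] := pent_farE P (or_introl tB).
  by move: xt; rewrite (negPf nxt) (negPf tx).
case=> [[/near_sideP[yB yB' yw yw'] yx]|[yB yb]].
  rewrite /S !inE !negb_or yx yw yw' /=; apply/andP; split.
    by apply: contraNneq yB => ->; apply: pent_bB P.
  by apply: contraNneq yB' => ->; apply: pent_zB' P.
rewrite /S !inE !negb_or yb /=.
have ne t : t \notin B -> y != t by apply: contraNneq => <-.
have zB : z \notin B by apply/negP => /(pent_disj P); rewrite (pent_zB' P).
rewrite (ne x) ?(ne w) ?(ne w') ?(ne z) //; apply: notB.
- by rewrite (pent_xw' P).
- by rewrite (pent_xw P).
by rewrite eqxx orbT.
Qed.

(** A gem has only three nonadjacent pairs, with excesses at least 2, 2, 1, which doubles to 10. The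
    missing 2 comes from [s], which is off the cycle because [w] is adjacent to all the rest of
    it. *)
Lemma pent_gem : adj z w -> adj w w' -> (forall y, ~~ gem_obstruction y) ->
  (exists2 s, s != w & ~~ adj w s) -> 4 * gorder G <= total_excess G + 8.
Proof.
move=> zw aww' ngem [s sw nws].
have [[dxw dxw' dwb dwz dbz] [dxb dxz dbw' dzw dww']] := pent_dists P.
have [[xb xz wb wz wb'] [wz' nbz xw xw' ww']] := pent_distinct P.
have [bz [axw' [w'z awb]]] := (pent_bz P, (pent_xw' P, (pent_w'z P, pent_wb P))).
have axw := pent_xw P.
have [xS wS w'S bS zS] := pent_inS x w w' b z.
have dzw1 := adj_dist1 zw; have dww1 := adj_dist1 aww'.
have sS : s \notin S.
  rewrite /S !inE !negb_or sw /=; apply/and4P; split; apply: contraNneq nws => -> //;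
  by rewrite adj_sym.
have base : 10 <= inner_excess S.
  have e1 : 2 <= excess x z by apply: (@excess_ge2 _ _ w w') => //; dlia distC.
  have e2 : 2 <= excess b w' by apply: (@excess_ge2 _ _ w z) => //; dlia distC.
  have e3 : 1 <= excess x b by apply: (@excess_ge1 _ _ w' z) => //; dlia distC.
  pent_pairs [:: (x, z); (b, w'); (x, b)].
have dsw : 1 < dist s w by rewrite (distC s) nadj_dist // eq_sym.
apply: (pent_total_extra base ngem sS).
case: (pent_outS B B' sS) => [[sA sx]|[sB sb]|[sB' sz]].
- have [dsx sw0 sw' dsb dsz] := near_dists P sA sx.
  have [E1|E2] : dist s w' = 1 \/ dist s w' = 2 by dlia distC.
    have e1 : 2 <= excess s b by apply: (@excess_ge2 _ _ w z) => //; dlia distC.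
    have e2 : 1 <= excess s w by apply: ltnW; apply: (@excess_ge2 _ _ x w') => //; dlia distC.
    by apply: leq_trans (excess_to2 bS wS _ e1 e2) => //; rewrite eq_sym.
  have e1 : 2 <= excess s z by apply: (@excess_ge2 _ _ w w') => //; dlia distC.
  have e2 : 1 <= excess s b by apply: (@excess_ge1 _ _ w' z) => //; dlia distC.
  by apply: leq_trans (excess_to2 zS bS _ e1 e2) => //; rewrite eq_sym.
- have [[sw0 sb0 sbw swb dsx] [dsw' dsz]] := far_dists P sB sb.
  have [lt|gt|E] := ltngtP (dist s w) (dist s b).
  + by have := ngem s; rewrite /gem_obstruction sB sb zw aww' lt.
  + have e1 : 2 <= excess s w' by apply: (@excess_ge2 _ _ w z) => //; dlia distC.
    have e2 : 1 <= excess s x by apply: (@excess_ge1 _ _ z w'); rewrite 1?adj_sym //; dlia distC.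
    by apply: leq_trans (excess_to2 w'S xS _ e1 e2) => //; rewrite eq_sym.
  have e1 : 2 <= excess s z by apply: (@excess_ge2 _ _ w b) => //; dlia distC.
  have e2 : 1 <= excess s w' by apply: (@excess_ge1 _ _ b z) => //; dlia distC.
  by apply: leq_trans (excess_to2 zS w'S _ e1 e2) => //; rewrite eq_sym.
by move: sB' sz; rewrite (adj_zw_B' P zw) inE => /eqP->; rewrite eqxx.
Qed.

Section Pentagon5.
Hypotheses (nzw : ~~ adj z w) (nww' : ~~ adj w w').

Lemma c5_excess : [/\ 1 <= excess x b, 1 <= excess x z, 1 <= excess b w',
  1 <= excess z w & 1 <= excess w w'].
Proof.
have [[dxw dxw' dwb dwz dbz] [dxb dxz dbw' dzw dww']] := pent_dists P.
have [[xb xz wb wz wb'] [wz' nbz xw xw' ww']] := pent_distinct P.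
have [bz [axw' [w'z awb]]] := (pent_bz P, (pent_xw' P, (pent_w'z P, pent_wb P))).
have axw := pent_xw P.
have d1 := nadj_dist ww' nww'; have d2 : 1 < dist z w by rewrite nadj_dist // eq_sym.
split.
- by apply: (@excess_ge1 _ _ w' z) => //; dlia distC.
- by apply: (@excess_ge1 _ _ w b) => //; dlia distC.
- by apply: (@excess_ge1 _ _ w x); rewrite 1?adj_sym //; dlia distC.
- by apply: (@excess_ge1 _ _ w' x); rewrite 1?adj_sym //; dlia distC.
by apply: (@excess_ge1 _ _ b z) => //; dlia distC.
Qed.

Lemma c5_no_gem y : ~~ gem_obstruction y.
Proof. by rewrite /gem_obstruction (negPf nzw) !andbF. Qed.

(** A chordless 5-cycle has five nonadjacent pairs. With 1 for each the doubled sum is 10; the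
    excess of [w] and [w'] is kept as a parameter because [c5_near] can raise it to 2. *)
Lemma c5_inner k : k <= excess w w' -> 8 + 2 * k <= inner_excess S.
Proof.
have [[xb xz wb wz wb'] [wz' nbz xw xw' ww']] := pent_distinct P.
have [e1 e2 e3 e4 _] := c5_excess => e5.
have -> : 8 + 2 * k = (4 + k).*2 by rewrite -muln2; dlia distC.
pent_pairs [:: (x, b); (x, z); (b, w'); (z, w); (w, w')].
Qed.

Lemma c5_extra y : (y \in near_side w w' B B' /\ y != x) \/ (y \in B /\ y != b) ->
  3 <= excess_to S y -> 4 * gorder G <= total_excess G + 8.
Proof.
have [_ _ _ _ e5] := c5_excess => yP; apply: (pent_total_extra (c5_inner e5) c5_no_gem).
exact: pentS_notin.
Qed.

(** By 2-connectedness some near vertex [a] other than [x] is adjacent to [w] or [w']. If to only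
    one of them, [a] has excess 3 with the cycle; if to both, [a] is a second middle vertex between
    [w] and [w']. *)
Lemma c5_near y : y \in near_side w w' B B' -> y != x ->
  4 * gorder G <= total_excess G + 8.
Proof.
move=> yA0 yx0.
have [[dxw dxw' dwb dwz dbz] [dxb dxz dbw' dzw dww']] := pent_dists P.
have [[xb xz wb wz wb'] [wz' nbz xw xw' ww']] := pent_distinct P.
have [bz [axw' [w'z awb]]] := (pent_bz P, (pent_xw' P, (pent_w'z P, pent_wb P))).
have axw := pent_xw P.
have [xS wS w'S bS zS] := pent_inS x w w' b z.
have d1 := nadj_dist ww' nww'; have d2 : 1 < dist z w by rewrite nadj_dist // eq_sym.
have wA : w \notin near_side w w' B B' by rewrite !inE eqxx !orbT.
have [||||a [q [aX qX ax qx aq]]] := @exit_avoiding x (near_side w w' B B' :\ x) y w.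
- by rewrite inE yA0 inE yx0.
- by rewrite inE (negPf wA) andbF.
- by [].
- by rewrite eq_sym.
have aA : a \in near_side w w' B B' by move: aX; rewrite inE => /andP[].
have qA : q \notin near_side w w' B B' by apply: contraNN qX => qA; rewrite inE qA inE qx.
have [dax aw aw' ab az] := near_dists P aA ax.
have dw : dist a w = 1 \/ dist a w' = 1.
  by case: (near_exit P aA qA aq) => E; [left|right]; rewrite -E adj_dist1.
have [lt|gt|E] := ltngtP (dist a w) (dist a w').
- apply: (c5_extra (or_introl (conj aA ax))).
  have e1 : 2 <= excess a z by apply: (@excess_ge2 _ _ w' b) => //; dlia distC.
  have e2 : 1 <= excess a w' by apply: (@excess_ge1 _ _ b z) => //; dlia distC.
  by apply: leq_trans (excess_to2 zS w'S _ e1 e2) => //; rewrite eq_sym.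
- apply: (c5_extra (or_introl (conj aA ax))).
  have e1 : 2 <= excess a b by apply: (@excess_ge2 _ _ w z) => //; dlia distC.
  have e2 : 1 <= excess a w by apply: (@excess_ge1 _ _ z b); rewrite 1?adj_sym //; dlia distC.
  by apply: leq_trans (excess_to2 bS wS _ e1 e2) => //; rewrite eq_sym.
apply: pent_total_base c5_no_gem; apply: (@c5_inner 2).
by apply: (@excess_ge2 _ _ x a); rewrite 1?eq_sym //; dlia distC.
Qed.

(** A vertex of [B] other than [b] that is equidistant from [w] and [b] has excess 3 with the cycle.
    If there is none, [B] without [b] splits into vertices nearer to [b] and vertices nearer to [w],
    and an end of an edge between the two kinds is used. *)
Lemma c5_far y : y \in B -> y != b -> 4 * gorder G <= total_excess G + 8.
Proof.
move=> yB0 yb0.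
have [[dxw dxw' dwb dwz dbz] [dxb dxz dbw' dzw dww']] := pent_dists P.
have [[xb xz wb wz wb'] [wz' nbz xw xw' ww']] := pent_distinct P.
have [bz [axw' [w'z awb]]] := (pent_bz P, (pent_xw' P, (pent_w'z P, pent_wb P))).
have axw := pent_xw P.
have [xS wS w'S bS zS] := pent_inS x w w' b z.
have d1 := nadj_dist ww' nww'; have d2 : 1 < dist z w by rewrite nadj_dist // eq_sym.
have xB : x \notin B by apply/negP => xB; have [] := pent_farE P (or_introl xB); rewrite eqxx.
pose ok y := [&& y \in B, y != b & dist y w == dist y b].
have [/existsP[a /and3P[aB ab /eqP E]]|noeq] := boolP [exists y, ok y].
  apply: (c5_extra (or_intror (conj aB ab))).
  have [[aw0 ab0 abw awb' dax] [daw' daz]] := far_dists P aB ab.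
  have e1 : 2 <= excess a w' by apply: (@excess_ge2 _ _ x z) => //; dlia distC.
  have e2 : 1 <= excess a x by apply: (@excess_ge1 _ _ z w'); rewrite 1?adj_sym //; dlia distC.
  by apply: leq_trans (excess_to2 w'S xS _ e1 e2) => //; rewrite eq_sym.
have {}noeq a : a \in B -> a != b -> dist a w <> dist a b.
  by move=> aB ab E; case/negP: noeq; apply/existsP; exists a; rewrite /ok aB ab E eqxx.
have [||||t [r [tX rX tw rw tr]]] := @exit_avoiding w (B :\ b) y x.
- by rewrite !inE yb0.
- by rewrite !inE (negPf xB) andbF.
- by apply: contraTneq yB0 => ->; apply/negP => wB;
    have [_] := pent_farE P (or_introl wB); rewrite axw.
- by [].
move: tX; rewrite !inE => /andP[tb tB].
have {r rX rw tr} tb1 : adj t b.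
  case/or3P: (pent_B P tB tr) => [rB|/eqP Er|/andP[/eqP Et _]].
  - by move: rX; rewrite !inE rB andbT negbK => /eqP <-.
  - by rewrite Er eqxx in rw.
  by rewrite Et eqxx in tb.
have dtb := adj_dist1 tb1.
have [[tw0 tb0 tbw twb dtx] _] := far_dists P tB tb.
have tneq := noeq t tB tb.
(* [X] contains [t]. An edge leaving [X] and avoiding [b] stays in [B] and ends in a vertex [r]
   nearer to [w]. *)
pose X := [set a in B :\ b | dist a b < dist a w].
have [||||a [r [aX rX nab rb ar]]] := @exit_avoiding b X t x.
- by rewrite !inE tb tB /=; dlia distC.
- by rewrite !inE (negPf xB) andbF.
- by [].
- by [].
move: aX; rewrite !inE => /andP[/andP[ab aB] alt].
have [[aw0 ab0 abw awb' dax] _] := far_dists P aB ab.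
have rB : r \in B.
  case/or3P: (pent_B P aB ar) => [//|/eqP Er|/andP[/eqP Et _]].
    by have := adj_dist1 ar; rewrite Er; dlia distC.
  by rewrite Et eqxx in ab.
have rneq := noeq r rB rb.
have rlt : dist r w < dist r b by move: rX; rewrite !inE rb rB /=; dlia distC.
have [[rw0 rb0 rbw rwb drx] [drw' drz]] := far_dists P rB rb.
have dar := adj_dist1 ar.
have s1 := dist_step w ar; have s2 := dist_step b ar.
have s3 := dist_tri r w a.
(* Both [a] and the vertex [c] following [r] on a geodesic to [w] are first steps of geodesics from
   [r] to [b]; they differ in their distance to [w]. *)
have [|c cr dwc] := @dist_pred w r (dist r w).-1; first by dlia distC.
have dcr := adj_dist1 cr; have tc := dist_tri w c b; have trc := dist_tri c r b.
apply: (c5_extra (or_intror (conj rB rb))).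
have e1 : 2 <= excess r b.
  apply: (@excess_ge2 _ _ a c); [|dlia distC..].
  by apply/eqP => E; rewrite -E in dwc; dlia distC.
have e2 : 1 <= excess r w' by apply: (@excess_ge1 _ _ b z) => //; dlia distC.
by apply: leq_trans (excess_to2 bS w'S _ e1 e2) => //; rewrite eq_sym.
Qed.

End Pentagon5.
End Pent.

Lemma pent_c5 (x w w' b z : G) (B B' : {set G}) :
  pentagon x w w' b z B B' -> ~~ adj z w -> ~~ adj w w' -> 6 <= gorder G ->
  4 * gorder G <= total_excess G + 8.
Proof.
move=> P nzw nww' G6.
have [y yS] : exists y, y \notin pentagon_set x w w' b z.
  case: (pickP (fun y => y \notin pentagon_set x w w' b z)) => [y yS|all_in].
    by exists y.
  suff : 6 <= #|pentagon_set x w w' b z| by rewrite (card_pentS P).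
  apply: leq_trans G6 _; apply: subset_leq_card; apply/subsetP => t _.
  by rewrite -[_ \in _]negbK all_in.
case: (pent_outS B B' yS) => [[yA yx]|[yB yb]|[yB' yz]].
- exact: (c5_near P nzw nww' yA yx).
- exact: (c5_far P nzw nww' yB yb).
have P' := pentagon_swap P nzw.
apply: (c5_far P' _ _ yB' yz); last by rewrite adj_sym.
by rewrite (pent_nbw' P).
Qed.

(** * Vertices of small excess *)

Section Light.



Variable x : G.
Hypothesis light : excess_to [set: G] x <= 3.

(* The neighbours of [x] that lie on a geodesic from [x] to [v]. *)
Let anc v : {set G} := level x v 1.
Let far v : bool := 1 < dist x v.

Lemma in_anc v a : (a \in anc v) = adj x a && (dist a v + 1 == dist x v).
Proof. by rewrite inE -dist_eq1; case: eqP => //= ->; rewrite addnC. Qed.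

Lemma anc_sub q v : far q -> adj q v -> dist x q < dist x v -> anc q \subset anc v.
Proof.
move=> fq qv lt; apply/subsetP => a; rewrite !in_anc => /andP[xa /eqP E]; rewrite xa /=.
have := dist_step x qv; have := dist_step a qv; have := dist_tri a x v.
by rewrite (adj_dist1 xa); dlia distC.
Qed.

Lemma anc_gt0 v : far v -> 0 < #|anc v|.
Proof. by move=> fv; apply: (level_gt0); rewrite ltnW. Qed.

Lemma anc1 v a : far v -> #|anc v| <= 1 -> a \in anc v -> anc v = [set a].
Proof.
move=> fv le1 av; apply/eqP; rewrite eq_sym eqEcard sub1set av cards1.
exact: le1.
Qed.

Lemma anc2_excess v : far v -> 1 < #|anc v| -> 2 <= excess x v.
Proof.
move=> fv gt1; have /(_ fv) := @excess_level x v 1.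
by rewrite -/(anc v); move: (#|anc v|) gt1 => k; dlia distC.
Qed.

Lemma light_list (l : seq G) : uniq l -> \sum_(v <- l) excess x v <= 3.
Proof. by move=> ul; apply: leq_trans (excess_to_ge _ ul _) light => s; rewrite inE. Qed.

Lemma light2 u v : u != v -> excess x u + excess x v <= 3.
Proof.
move=> uv; have := @light_list [:: u; v]; rewrite /= !big_cons big_nil inE uv addn0.
exact.
Qed.

Lemma light3 u v t : u != v -> u != t -> v != t ->
  excess x u + excess x v + excess x t <= 3.
Proof.
move=> uv ut vt; have := @light_list [:: u; v; t].
by rewrite /= !big_cons big_nil !inE negb_or uv ut vt addn0 addnA => /(_ isT).
Qed.

Lemma light4 u v t s : uniq [:: u; v; t; s] ->
  excess x u + excess x v + excess x t + excess x s <= 3.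
Proof. by move/light_list; rewrite !big_cons big_nil addn0 !addnA. Qed.

(* The edges leading from the ancestor [a] to [z] are good for the pair [x, b],
   but none of them lies on a geodesic from [x] to [b]. *)
Lemma cross_excess b z a : far b -> adj b z -> dist x z = dist x b ->
  a \in anc z -> a \notin anc b ->
  1 <= excess x b /\ (3 <= dist x b -> 2 <= excess x b).
Proof.
move=> fb bz E; have fb1 : 1 < dist x b := fb; rewrite !in_anc => /andP[xa /eqP az]; rewrite xa /= => /eqP nab.
have dbz := adj_dist1 bz; have dxa := adj_dist1 xa; have t0 := dist_tri a x b.
have [|p pz dap] := @dist_pred a z (dist x b - 2); first by dlia distC.
have dpz := adj_dist1 pz; have t1 := dist_tri a x p; have t2 := dist_tri p x z.
have t3 := dist_tri p a b; have t4 := dist_tri z b p.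
have g1 : (p, z) \in nongeo x b by rewrite !inE /= pz; dlia distC.
split; first by apply: leq_trans (nongeo_le x b); apply/card_gt0P; exists (p, z).
move=> b3; have [|r rp dar] := @dist_pred a p (dist x b - 3); first by dlia distC.
have drp := adj_dist1 rp; have t5 := dist_tri a x r; have t6 := dist_tri r x p.
have t7 := dist_tri r a b; have t8 := dist_tri p b r; have t9 := dist_tri z p b.
have t10 := dist_tri p r b.
have g2 : (r, p) \in nongeo x b by rewrite !inE /= rp; dlia distC.
apply: leq_trans (nongeo_le x b); apply/card_gt1P; exists (p, z), (r, p); split=> //.
by rewrite xpair_eqE; apply/nandP; left; apply: contraTneq rp => ->; rewrite adj_irr.
Qed.

(** Either [bc] is an edge and [cross_excess] applies, or the edge [cz] is good for [[x, b]] but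
    leads beyond the distance of [b]. *)
Lemma fork_excess b c z a : far b -> adj b z -> adj c z -> dist x c = dist x b ->
  dist x z = (dist x b).+1 -> a \in anc c -> a \notin anc b -> 1 <= excess x b.
Proof.
move=> fb bz cz Ec Ez ac nab; have fb1 : 1 < dist x b := fb.
have [bc|nbc] := boolP (adj b c); first by have [] := cross_excess fb bc Ec ac nab.
have bnc : b != c by apply: contraNneq nab => ->.
have := nadj_dist bnc nbc; have := adj_dist1 bz => d1 d2.
by apply: (@excess_ge1 _ _ c z) => //; dlia distC.
Qed.

Definition own w : {set G} := [set v | far v && (anc v == [set w])].

(** All other positions exceed the budget of 3. If [z] is farther than [b], then [b], [z] and
    another predecessor [c] of [z] have excesses at least 1, 2, 1. If both are at the same distance
    3 or more, each has excess at least 2. And [z] cannot be nearer, since its ancestors would be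
    ancestors of [b]. *)
Lemma own_cross w b z : b \in own w -> z \notin own w -> z != w -> adj b z ->
  [/\ dist x b = 2, dist x z = 2 & exists2 a, a \in anc z & a != w].
Proof.
rewrite !inE => /andP[fb /eqP ab] + zw bz.
have wb : w \in anc b by rewrite ab inE.
have [s1 s2] := (dist_step x bz, dist_step x (etrans (adj_sym _ _) bz)).
have fb1 : 1 < dist x b := fb.
(* A neighbour [z] of [x] would be an ancestor of [b], hence equal to [w]. *)
have fz : far z.
  rewrite /far ltnNge; apply/negP => zle.
  have xz : adj x z by rewrite -dist_eq1; dlia distC.
  have : z \in anc b.
    by have := adj_dist1 xz; have := adj_dist1 bz; rewrite in_anc xz /=; dlia distC.
  by rewrite ab inE (negPf zw).
rewrite fz /= => nz.
have [a az aw] : exists2 a, a \in anc z & a != w.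
  have /card_gt0P[a az] := anc_gt0 fz; have [Ea|aw] := eqVneq a w; last by exists a.
  rewrite {}Ea in az; have : ~~ (anc z \subset [set w]).
    by apply: contraNN nz => sub; rewrite eqEsubset sub sub1set.
  by case/subsetPn => c cz; rewrite inE => cw; exists c.
have anb : a \notin anc b by rewrite ab inE.
have nlt : ~~ (dist x z < dist x b).
  apply/negP => lt; case/negP: anb; apply: (subsetP (anc_sub fz _ lt)) az.
  by rewrite adj_sym.
have bnz : b != z by exact: adj_neq.
case: (ltngtP (dist x b) (dist x z)) => [lt|lt|E]; last first.
- have [e1 e2] := cross_excess fb bz (esym E) az anb.
  have [b3|b2] := leqP 3 (dist x b); last first.
    by split; [dlia distC|dlia distC|exists a].
  have := light2 bnz; have := e2 b3.
  suff : 2 <= excess x z by dlia distC.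
  have [z1|z2] := leqP #|anc z| 1; last exact: anc2_excess.
  have wz : w \notin anc z by rewrite (anc1 fz z1 az) inE eq_sym.
  have zb : adj z b by rewrite adj_sym.
  by have [_ -> //] := cross_excess fz zb E wb wz; rewrite -E.
- by rewrite lt in nlt.
have wz : w \in anc z := subsetP (anc_sub fb bz lt) w wb.
have ez : 2 <= excess x z.
  by apply: anc2_excess => //; apply/card_gt1P; exists a, w.
have Ez : dist x z = (dist x b).+1 by dlia distC.
have [xa /eqP daz] := andP (etrans (esym (in_anc z a)) az).
have dxa := adj_dist1 xa.
have [|c cz dac] := @dist_pred a z (dist x b).-1.
  by dlia distC.
have := adj_dist1 cz; have := dist_tri a x c; have := dist_tri c x z => t1 t2 dcz.
have Ec : dist x c = dist x b by dlia distC.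
have fc : far c by rewrite /far Ec.
have ac : a \in anc c by rewrite in_anc xa /=; dlia distC.
have eb := fork_excess fb bz cz Ec Ez ac anb.
have bc : b != c by apply: contraNneq anb => ->.
have cnz : c != z by exact: adj_neq.
have ec : 1 <= excess x c.
  have [c1|c2] := leqP #|anc c| 1; last by apply: ltnW; apply: anc2_excess.
  have wc : w \notin anc c by rewrite (anc1 fc c1 ac) inE eq_sym.
  by apply: (fork_excess fc cz bz (esym Ec) _ wb wc); rewrite Ec.
by have := light3 bnz bc; rewrite eq_sym cnz => /(_ isT); dlia distC.
Qed.

Lemma farE v : far v = (v != x) && ~~ adj x v.
Proof.
by rewrite /far -dist_eq1 (eq_sym v) -dist_eq0; case: (dist x v) => [|[|k]].
Qed.

Lemma in_anc2 v a : dist x v = 2 -> (a \in anc v) = adj x a && adj a v.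
Proof. by move=> d2; rewrite in_anc -[adj a v]dist_eq1 d2 addn1. Qed.

Lemma own_exit w v : v \in own w ->
  exists b z, [/\ b \in own w, z \notin own w, z != w & adj b z].
Proof.
move=> vw; have [||||b [z [bw zw _ zx bz]]] := @exit_avoiding w (own w) v x.
- exact: vw.
- by rewrite inE farE eqxx.
- move: vw; rewrite !inE => /andP[fv /eqP E]; have : w \in anc v by rewrite E inE.
  by rewrite in_anc => /andP[xw _]; apply: contraTneq fv => ->; rewrite farE xw andbF.
- move: vw; rewrite !inE => /andP[fv /eqP E]; have : w \in anc v by rewrite E inE.
  by rewrite in_anc => /andP[xw _]; exact: adj_neq.
by exists b, z.
Qed.

Lemma nongeo_anc b z a : adj b z -> dist x b = 2 -> dist x z = 2 ->
  a \in anc z -> a \notin anc b -> (a, z) \in nongeo x b.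
Proof.
move=> bz db dz; rewrite !in_anc2 // => /andP[xa az]; rewrite xa /= => nab.
have dxa := adj_dist1 xa; have dbz := adj_dist1 bz.
have bna : b != a by apply/eqP => E; rewrite E in db; dlia distC.
have := nadj_dist bna; rewrite (adj_sym b) nab => /(_ isT) dba.
by rewrite !inE /= az; dlia distC.
Qed.

Lemma excess_nongeo2 b (e f : G * G) : e != f -> e \in nongeo x b -> f \in nongeo x b ->
  2 <= excess x b.
Proof.
by move=> ef eb fb; apply: leq_trans (nongeo_le x b); apply/card_gt1P; exists e, f.
Qed.

Lemma own_anc w v : v \in own w -> far v /\ anc v = [set w].
Proof. by rewrite inE => /andP[fv /eqP ->]. Qed.

(** Every far vertex has excess at least 2, so there is only one, and a third ancestor would raise
    its excess to 4. *)
Lemma light_typeA : (forall v, far v -> 1 < #|anc v|) -> (exists v, far v) ->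
  exists v w1 w2, [/\ forall y, y != x -> y != v -> adj x y,
    x != v, ~~ adj x v, w1 != w2 & forall y, adj v y = (y == w1) || (y == w2)].
Proof.
move=> multi [v fv]; have := fv; rewrite farE => /andP[vx nxv].
have adjx y : y != x -> y != v -> adj x y.
  move=> yx yv; apply: contraTT isT => nxy.
  have fy : far y by rewrite farE yx nxy.
  have := light2 yv; have := anc2_excess fy (multi y fy).
  by have := anc2_excess fv (multi v fv); dlia distC.
have dv : dist x v = 2.
  have fv1 : 1 < dist x v := fv; have [k Ek dkv] := @dist_at x v 2 fv1.
  have [kx|kx] := eqVneq k x; first by rewrite kx dist0 in Ek.
  have [kv|kv] := eqVneq k v; first by rewrite -kv.
  by have := adj_dist1 (adjx k kx kv); dlia distC.
have /card_gt1P[w1 [w2 [w1v w2v w12]]] := multi v fv.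
have le2 : #|anc v| <= 2.
  have := @excess_level x v 1; rewrite dv => /(_ isT); rewrite -/(anc v).
  have := @light_list [:: v] isT; rewrite big_seq1.
  by move: (#|anc v|) => k; dlia distC.
have ancE : anc v = [set w1; w2].
  apply/eqP; rewrite eq_sym eqEcard cards2 w12 le2 andbT.
  by apply/subsetP => a; rewrite in_set2 => /orP[]/eqP->.
exists v, w1, w2; split=> // [|y]; first by rewrite eq_sym.
rewrite -in_set2 -ancE in_anc2 // (adj_sym v).
have [->|yx] := eqVneq y x; first by rewrite (negPf nxv) adj_irr.
have [->|yv] := eqVneq y v; first by rewrite adj_irr andbF.
by rewrite adjx.
Qed.

(** An edge [bz] leaving [own w] closes the 5-cycle through [x]. What is left of the budget of 3
    excludes every other connection between the two sides, which then are [own w] and either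
    [[set z]] or [own w']. *)
Lemma light_typeB v0 : far v0 -> #|anc v0| <= 1 ->
  exists w w' b z B B', pentagon x w w' b z B B'.
Proof.
move=> fv0 v01; have /card_gt0P[w wv0] := anc_gt0 fv0.
have v0w : v0 \in own w by rewrite inE fv0 (anc1 fv0 v01 wv0) eqxx.
have [b [z [bw zw znw bz]]] := own_exit v0w.
have [fb ancb] := own_anc bw.
have [db dz [w' w'z w'w]] := own_cross bw zw znw bz.
have fz : far z by rewrite /far dz.
have w'b : w' \notin anc b by rewrite ancb inE.
have wb : w \in anc b by rewrite ancb inE.
have [eb _] := cross_excess fb bz (etrans dz (esym db)) w'z w'b.
have bnz : b != z by exact: adj_neq.
have /andP[xw awb] : adj x w && adj w b by rewrite -in_anc2.
have /andP[xw' aw'z] : adj x w' && adj w' z by rewrite -in_anc2.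
have single v : far v -> #|anc v| <= 1 -> exists2 a, v \in own a & a \in anc v.
  move=> fv v1; have /card_gt0P[a av] := anc_gt0 fv.
  by exists a => //; rewrite inE fv (anc1 fv v1 av) eqxx.
(* If [z] has two ancestors, then [z] and [b] use 2 + 1, and every other vertex has excess 0. *)
have [z1|z2] := leqP #|anc z| 1; last first.
  have ez := anc2_excess fz z2.
  have others v : far v -> v != z -> v \in own w.
    move=> fv vz; have [v1|v2] := leqP #|anc v| 1; last first.
      have vb : v != b by apply: contraTneq v2 => ->; rewrite ancb cards1.
      have := light3 bnz (_ : b != v) (_ : z != v); rewrite 2![_ == v]eq_sym => /(_ vb vz).
      by have := anc2_excess fv v2; dlia distC.
    have [a va _] := single v fv v1; have [b2 [z2' [b2a z2a z2n bz2]]] := own_exit va.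
    have [db2 dz2 [a2 a2z a2a]] := own_cross b2a z2a z2n bz2.
    have [fb2 ancb2] := own_anc b2a.
    have a2b : a2 \notin anc b2 by rewrite ancb2 inE.
    have [eb2 _] := cross_excess fb2 bz2 (etrans dz2 (esym db2)) a2z a2b.
    have [E|nb] := eqVneq b2 b.
      by have := ancb; rewrite -E ancb2 => /setP/(_ a); rewrite !in_set1 eqxx => /esym/eqP <-.
    have [E|nz] := eqVneq b2 z; first by move: z2; rewrite -E ancb2 cards1.
    have := light3 bnz (_ : b != b2) (_ : z != b2); rewrite 2![_ == b2]eq_sym => /(_ nb nz).
    by dlia distC.
  have cross y q : y \in own w -> q \notin own w -> q != w -> adj y q -> y = b /\ q = z.
    move=> yw qw qnw yq; have [dy dq [a aq aw]] := own_cross yw qw qnw yq.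
    have [fy ancy] := own_anc yw.
    have ay : a \notin anc y by rewrite ancy inE.
    have [ey _] := cross_excess fy yq (etrans dq (esym dy)) aq ay.
    have yz : y != z by apply: contraTneq z2 => <-; rewrite ancy cards1.
    have fq : far q by rewrite /far dq.
    split; apply: contraTeq isT; last first.
      by move=> qz; case/negP: qw; apply: others.
    move=> yb; have := light3 bnz (_ : b != y) (_ : z != y).
    by rewrite 2![_ == y]eq_sym => /(_ yb yz); dlia distC.
  have le2 : #|anc z| <= 2.
    have := @excess_level x z 1; rewrite dz => /(_ isT); rewrite -/(anc z).
    by have := light2 bnz; move: (#|anc z|) => k; dlia distC.
  (* Otherwise two ancestors of [z] would send two edges to [z] that are off the geodesics from [x]
     to [b], giving [b] excess 2. *)
  have wz : w \in anc z.
    apply: contraTT isT => wz; have /card_gt1P[a [a' [az a'z aa']]] := z2.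
    have out c : c \in anc z -> c \notin anc b.
      by move=> cz; rewrite ancb inE; apply: contraNneq wz => <-.
    have := excess_nongeo2 _ (nongeo_anc bz db dz az (out _ az)) (nongeo_anc bz db dz a'z (out _ a'z)).
    by rewrite xpair_eqE (negPf aa') => /(_ isT); have := light2 bnz; dlia distC.
  have ancz : anc z = [set w; w'].
    apply/eqP; rewrite eq_sym eqEcard cards2 (eq_sym w) w'w le2 andbT.
    by apply/subsetP => a; rewrite in_set2 => /orP[]/eqP->.
  exists w, w', b, z, (own w), [set z]; split=> //.
  - by rewrite eq_sym.
  - by rewrite inE.
  - move=> y; rewrite in_set1 -farE; apply/orP/idP => [[/own_anc[] //|/eqP->//]|fy].
    by have [yz|yz] := eqVneq y z; [right|left; apply: others].
  - by move=> y yw; rewrite in_set1; apply: contraNneq zw => <-.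
  - move=> y q yw yq; have [//|qw] := boolP (q \in own w).
    have [//|qnw] := eqVneq q w.
    by have [-> ->] := cross y q yw qw qnw yq; rewrite !eqxx.
  move=> y q; rewrite !in_set1 => /eqP-> zq; rewrite !eqxx andbT /=.
  have qz : q != z by rewrite eq_sym adj_neq.
  have qx : q != x by apply: contraTneq zq => ->; move: fz; rewrite farE adj_sym => /andP[].
  have [xq|nxq] := boolP (adj x q).
    have : q \in anc z by rewrite in_anc2 // xq adj_sym.
    by rewrite ancz in_set2 => /orP[]->; rewrite ?orbT.
  have fq : far q by rewrite farE qx.
  have qz' : adj q z by rewrite adj_sym.
  by have [-> _] := cross q z (others q fq qz) zw znw qz'; rewrite eqxx !orbT.
have ancz := anc1 fz z1 w'z.
have zw' : z \in own w' by rewrite inE fz ancz eqxx.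
(* An edge between vertices at distance 2 with different single ancestors; each of its ends has
   excess at least 1. Two disjoint such edges cost 4. Two at a common vertex also cost 4, because
   that vertex has excess 2. So [bz] is the only one. *)
pose cr y p := [/\ dist x y = 2, dist x p = 2, adj y p &
  exists a a', [/\ anc y = [set a], anc p = [set a'] & a != a']].
have crC y p : cr y p -> cr p y.
  case=> dy dp yp [a [a' [E E' aa']]]; split=> //; first by rewrite adj_sym.
  by exists a', a; rewrite eq_sym.
have crbz : cr b z by split=> //; exists w, w'; rewrite eq_sym.
have cr1 y p : cr y p -> 1 <= excess x y.
  case=> dy dp yp [a [a' [E E' aa']]].
  have fy : far y by rewrite /far dy.
  have a'p : a' \in anc p by rewrite E' inE.
  have a'y : a' \notin anc y by rewrite E inE eq_sym.
  by have [] := cross_excess fy yp (etrans dp (esym dy)) a'p a'y.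
have cr2 y p q : cr y p -> cr y q -> p = q.
  move=> yp yq; apply: contraTeq isT => pq.
  have ep := cr1 _ _ (crC _ _ yp); have eq := cr1 _ _ (crC _ _ yq).
  case: yp yq => dy dp yp [a [a' [E E' aa']]] [_ dq yq [c [c' [F F' cc']]]].
  have ey : 2 <= excess x y.
    apply: (@excess_nongeo2 y (a', p) (c', q)).
    - by rewrite xpair_eqE (negPf pq) andbF.
    - by apply: nongeo_anc; rewrite // ?E' ?E inE // eq_sym.
    by apply: nongeo_anc; rewrite // ?F' ?F inE // eq_sym.
  have := light3 (adj_neq yp) (adj_neq yq) pq; dlia distC.
have cr3 y p : cr y p -> (y = b /\ p = z) \/ (y = z /\ p = b).
  move=> yp; have crzb := crC _ _ crbz; have py := crC _ _ yp.
  have [Ey|yb] := eqVneq y b; first by left; rewrite Ey in yp *; rewrite (cr2 _ _ _ yp crbz).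
  have [Ey|yz] := eqVneq y z; first by right; rewrite Ey in yp *; rewrite (cr2 _ _ _ yp crzb).
  have [Ep|pb] := eqVneq p b; first by right; rewrite Ep in py *; rewrite (cr2 _ _ _ py crbz).
  have [Ep|pz] := eqVneq p z; first by left; rewrite Ep in py *; rewrite (cr2 _ _ _ py crzb).
  have := @light4 b z y p; rewrite /= !inE !negb_or bnz (eq_sym b y) (eq_sym b p) (eq_sym z y) (eq_sym z p).
  rewrite yb pb yz pz; have [_ _ ayp _] := yp; rewrite (adj_neq ayp) => /(_ isT).
  have := cr1 _ _ yp; have := cr1 _ _ py; have := cr1 _ _ crbz; have := cr1 _ _ crzb.
  by dlia distC.
have nomulti v : far v -> #|anc v| <= 1.
  move=> fv; rewrite leqNgt; apply/negP => v2.
  have vb : b != v by apply: contraTneq v2 => <-; rewrite ancb cards1.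
  have vz : z != v by apply: contraTneq v2 => <-; rewrite ancz cards1.
  have := light3 bnz vb vz; have := anc2_excess fv v2.
  by have := cr1 _ _ (crC _ _ crbz); dlia distC.
have crown a y q : y \in own a -> q \notin own a -> q != a -> adj y q -> cr y q.
  move=> ya qa qna yq; have [dy dq [c cq ca]] := own_cross ya qa qna yq.
  have fq : far q by rewrite /far dq.
  have [_ E] := own_anc ya; split=> //; exists a, c; split=> //.
    exact: anc1 fq (nomulti q fq) cq.
  by rewrite eq_sym.
have ownE a v : v \in own a -> a = w \/ a = w'.
  move=> va; have [b2 [z2 [b2a z2a z2n bz2]]] := own_exit va.
  have [_ E2] := own_anc b2a.
  have sing (c d : G) : [set c] = [set d] -> c = d.
    by move/setP/(_ c); rewrite !inE eqxx => /esym/eqP.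
  by case: (cr3 _ _ (crown a b2 z2 b2a z2a z2n bz2)) => -[E _]; [left|right];
    apply: sing; rewrite -E2 E.
have distinct a c v : v \in own a -> v \in own c -> a = c.
  move=> /own_anc[_ E] /own_anc[_ E']; move/setP/(_ a): E'.
  by rewrite E !inE eqxx => /esym/eqP.
exists w, w', b, z, (own w), (own w'); split=> //.
- by rewrite eq_sym.
- move=> y; rewrite -farE; apply/orP/idP => [[] /own_anc[] //|fy].
  have [a ya _] := single y fy (nomulti y fy).
  by case: (ownE a y ya) => E; rewrite E in ya; [left|right].
- move=> y yw; apply/negP => yw'; case/eqP: w'w; exact: distinct yw' yw.
- move=> y q yw yq; have [//|qw] := boolP (q \in own w).
  have [//|qnw] := eqVneq q w.
  case: (cr3 _ _ (crown w y q yw qw qnw yq)) => -[E E']; first by rewrite E E' !eqxx.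
  by rewrite E in yw; rewrite yw in zw.
move=> y q yw yq; have [//|qw] := boolP (q \in own w').
have [//|qnw] := eqVneq q w'.
case: (cr3 _ _ (crown w' y q yw qw qnw yq)) => -[E E']; last by rewrite E E' !eqxx.
by rewrite E in yw; case/eqP: w'w; exact: distinct yw bw.
Qed.

End Light.

(** * Reduction to an isometric subgraph *)

Section GemObstruction.




Variables (x w w' b z : G) (B B' : {set G}).
Hypothesis P : pentagon x w w' b z B B'.
Hypotheses (zw : adj z w) (aww' : adj w w').

Let near := near_side w w' B B'.
Let Q := ~: near.

Lemma in_gemQ t : (t \in Q) = (t \notin near).
Proof. exact: in_setC. Qed.

(** The near side is left only through [w] and [w']. These are adjacent, so a detour through the
    near side never shortens a path. *)
Lemma gem_geodesic u v : u \in Q -> v \in Q -> u != v ->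
  exists2 q, q \in Q & adj u q /\ dist q v < dist u v.
Proof.
move=> uQ vQ uv; have [|q qu dq] := @dist_pred v u (dist u v).-1.
  by move: uv; rewrite -dist_eq0; dlia distC.
have uv0 : 0 < dist u v by rewrite lt0n dist_eq0.
exists q; last by rewrite adj_sym; split=> //; dlia distC.
apply: contraTT isT => nqQ; have qA : q \in near by move: nqQ; rewrite in_gemQ negbK.
have uA : u \notin near by rewrite -in_gemQ.
have vA : v \notin near by rewrite -in_gemQ.
have gq := gateA P qA vA; have dww := adj_dist1 aww'.
have t1 := dist_tri w w' v; have t2 := dist_tri w' w v.
have qw : 0 < dist q w by rewrite lt0n dist_eq0; case/near_sideP: qA.
have qw' : 0 < dist q w' by rewrite lt0n dist_eq0; case/near_sideP: qA.
by case: (near_exit P qA uA qu) => E; rewrite E in dq uv0; dlia distC.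
Qed.

Lemma gem_connected2 : 2 < #|Q| -> k_connected 2 (induced Q).
Proof.
move=> Q2; split; first by rewrite -/(gorder _) gorder_induced.
move=> X; rewrite ltnS => X1 u v uX vX.
have [q Xq] : exists q : induced Q, X \subset [set q].
  case: (set_0Vmem X) => [->|[q qX]]; first by exists u; exact: sub0set.
  exists q; apply/subsetP => r rX; rewrite inE; move: X1; apply: contraTT => rq.
  by rewrite -ltnNge; apply/card_gt1P; exists r, q.
case: (set_0Vmem X) => [X0|[q' q'X]].
  have -> : connect [rel x y in ~: X | adj x y] u v = connect (@adj (induced Q)) u v.
    by apply: eq_connect => r s; rewrite /= X0 setC0 !inE.
  exact: induced_connect gem_geodesic u v.
have {Xq} EX : X = [set q].
  by apply/eqP; rewrite eqEsubset Xq sub1set; move/subsetP/(_ _ q'X): Xq; rewrite inE => /eqP <-.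
rewrite {}EX {X1 q' q'X X} in uX vX *.
set e := [rel r s in _ | _]; apply: contraTT isT => nuv.
pose C : {set G} := [set t | [exists s : induced Q, [&& val s == t, s != q & connect e u s]]].
have CP t : reflect (exists s : induced Q, [/\ val s = t, s != q & connect e u s]) (t \in C).
  rewrite inE; apply: (iffP existsP) => [[s /and3P[/eqP]]|[s [? ? ?]]]; exists s => //.
  by apply/and3P; split=> //; apply/eqP.
have CQ t : t \in C -> t \notin near.
  by case/CP => s [<- _ _]; rewrite -in_gemQ; exact: valP.
(* If [C] is the component of [u] in [Q] minus [q], then [X] adds the near side when it is attached
   to [C]. No edge of [G] avoiding [q] could leave [X], against the 2-connectedness of [G]. *)
pose X := if (w \in C) || (w' \in C) then C :|: near else C.
have CX t : t \in C -> t \in X by rewrite /X; case: ifP => // _ tC; rewrite inE tC.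
have Xnear t : t \notin near -> t \in X -> t \in C.
  by rewrite /X; case: ifP => // _ tA; rewrite inE (negPf tA) orbF.
have vQ : val v \notin near by rewrite -in_gemQ; exact: valP.
rewrite !inE in uX vX.
have uC : val u \in C by apply/CP; exists u.
have vC : val v \notin C.
  apply/negP => /CP[s [/val_inj-> _ us]]; by rewrite us in nuv.
have [||||a [c [aX cX aq cq ac]]] := @exit_avoiding (val q) X (val u) (val v).
- exact: CX.
- by apply/negP => /(Xnear _ vQ); rewrite (negPf vC).
- by rewrite (inj_eq val_inj).
- by rewrite (inj_eq val_inj).
have ext s t : s \in C -> t \notin near -> t != val q -> adj s t -> t \in C.
  case/CP => s' [<- sq us] tA tq st; have tQ : t \in Q by rewrite in_gemQ.
  apply/CP; exists (Sub t tQ); split=> //.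
  apply: connect_trans us (connect1 _); rewrite /= !inE sq /=.
  by rewrite -(inj_eq val_inj) tq.
have [aA|aA] := boolP (a \in near); last first.
  have aC := Xnear _ aA aX.
  have [cA|cA] := boolP (c \in near); last by case/negP: cX; apply: CX; exact: ext aC cA cq ac.
  rewrite adj_sym in ac; case/negP: cX; rewrite /X.
  by case: (near_exit P cA aA ac) => E; rewrite -E aC ?orbT inE cA orbT.
have wC : (w \in C) || (w' \in C).
  by move: aX; rewrite /X; case: ifP => // _ /CQ; rewrite aA.
have cA : c \notin near by apply: contraNN cX => cA; rewrite /X wC inE cA orbT.
case/negP: cX; apply: CX.
have ww : adj w' w by rewrite adj_sym.
by case: (near_exit P aA cA ac) => E; rewrite E in cA cq *; case/orP: wC => // h; apply: ext h _ _ _.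
Qed.

Lemma gem_growth y : y \notin Q -> 2 <= excess_to Q y.
Proof.
rewrite in_gemQ negbK => yA.
have inQ t : t \notin near -> t \in Q by rewrite in_gemQ.
have w'Q : w' \in Q by apply: inQ; rewrite !inE eqxx !orbT.
have bQ : b \in Q by apply: inQ; rewrite !inE (pent_bB P).
have zQ : z \in Q by apply: inQ; rewrite !inE (pent_zB' P) !orbT.
have [->|yx] := eqVneq y x; last exact: (near_excess P).
have [[dxw dxw' dwb dwz dbz] [dxb dxz dbw' dzw dww']] := pent_dists P.
have dzw1 := adj_dist1 zw.
apply: (excess_to1 zQ); apply: (@excess_ge2 _ _ w w'); first exact: pent_ww' P.
all: dlia distC.
Qed.

(** The obstruction makes [Q] large: it provides [y] and a neighbour [t] of [b] in [B], besides [b],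
    [w], [w'], [z]. The disjoint nonedges [w'b] and [zy] make the induced graph unexceptional, and
    [x] is not in [Q]. *)
Lemma gem_obstruction_reduction y : gem_obstruction w w' b z B y ->
  [/\ 6 <= #|Q| < gorder G, k_connected 2 (induced Q),
      unexceptional (gorder (induced Q)) (induced Q) &
      4 * #|Q| <= inner_excess Q + 8 -> 4 * gorder G <= total_excess G + 8].
Proof.
move=> /and5P[yB yb _ _ lt].
have inQ t : t \notin near -> t \in Q by rewrite in_gemQ.
have BQ t : t \in B -> t \in Q by move=> tB; apply: inQ; rewrite !inE tB.
have w'Q : w' \in Q by apply: inQ; rewrite !inE eqxx !orbT.
have wQ : w \in Q by apply: inQ; rewrite !inE eqxx !orbT.
have bQ := BQ b (pent_bB P); have yQ := BQ y yB.
have zQ : z \in Q by apply: inQ; rewrite !inE (pent_zB' P) !orbT.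
have [[xb xz wb wz wb'] [wz' nbz xw xw' ww']] := pent_distinct P.
have xB t : adj x t || (t == x) -> t \notin B.
  move=> xt; apply/negP => tB; have [tx nxt] := pent_farE P (or_introl tB).
  by move: xt; rewrite (negPf nxt) (negPf tx).
have wB : w \notin B by apply: xB; rewrite (pent_xw P).
have w'B : w' \notin B by apply: xB; rewrite (pent_xw' P).
have zB : z \notin B by apply/negP => /(pent_disj P); rewrite (pent_zB' P).
have [||||t [r [tX rX tw rw tr]]] := @exit_avoiding w (B :\ b) y x.
- by rewrite !inE yb.
- by rewrite !inE (negPf (xB x _)) ?andbF // eqxx orbT.
- by apply: contraNneq wB => <-.
- by [].
move: tX; rewrite !inE => /andP[tb tB].
have {r rX rw tr} tb1 : adj t b.
  case/or3P: (pent_B P tB tr) => [rB|/eqP Er|/andP[/eqP Et _]].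
  - by move: rX; rewrite !inE rB andbT negbK => /eqP <-.
  - by rewrite Er eqxx in rw.
  by rewrite Et eqxx in tb.
have ne s r : s \in B -> r \notin B -> s != r by move=> sB; apply: contraNneq => <-.
(* Since [y] is nearer to [w] than to [b], it is not adjacent to [b]. *)
have ty : y != t.
  have [[yw0 _ _ _ _] _] := far_dists P yB yb.
  by apply/eqP => E; have := adj_dist1 tb1; rewrite -E; dlia distC.
have Q6 : 6 <= #|Q|.
  pose l := [:: b; y; t; w; w'; z].
  have ul : uniq l.
    rewrite /= !inE !negb_or (eq_sym b y) (eq_sym b t) yb tb ty !(ne b) ?(pent_bB P) //.
    by rewrite !(ne y) ?(ne t) // ww' (eq_sym w z) (eq_sym w' z) (eq_sym z w) wz (eq_sym z w') wz'.
  rewrite (_ : 6 = #|[set s in l]|); last by rewrite cardsE; apply/esym/card_uniqP.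
  have lQ : all (mem Q) l by rewrite /= bQ yQ (BQ t tB) wQ w'Q zQ.
  by apply: subset_leq_card; apply/subsetP => s; rewrite inE => /(allP lQ).
have xQ : x \notin Q.
  rewrite in_gemQ negbK; apply/near_sideP; split=> //; first by rewrite xB ?eqxx ?orbT.
  by apply/negP => xB'; have [] := pent_farE P (or_intror xB'); rewrite eqxx.
have QG : #|Q| < gorder G.
  rewrite /gorder -cardsT; apply: proper_card; rewrite properE subsetT.
  by apply/subsetPn; exists x.
have conn2Q : k_connected 2 (induced Q) by apply: gem_connected2; apply: leq_trans Q6.
split; first by rewrite Q6.
- by [].
- move=> exc.
  apply: (@exceptional_no_two_nonedges _ (induced Q) (Sub w' w'Q) (Sub b bQ) (Sub z zQ) (Sub y yQ) exc).
  - rewrite /= !inE !negb_or -!(inj_eq val_inj) /=.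
    by rewrite wb' wz' nbz !(eq_sym _ y) yb !(ne y).
  - by rewrite /= /induced_rel /= adj_sym (pent_nbw' P).
  rewrite /= /induced_rel /=; apply/negP; rewrite adj_sym => /(pent_B P yB).
  by rewrite (negPf zB) (negPf yb) eq_sym (negPf wz).
move=> inner; have := growth (leqnn (inner_excess Q)) gem_growth.
by move: QG inner; move: (#|Q|) => k; dlia distC.
Qed.

End GemObstruction.

(** * Graphs with a dominating vertex *)

Section Dominated.



Variable w : G.
Hypothesis dom : forall y, y != w -> adj w y.

Definition in3 (S : {set G}) (t : G * G * G) := [&& t.1.1 \in S, t.1.2 \in S & t.2 \in S].
Definition in4 (S : {set G}) (t : (G * G) * (G * G)) :=
  [&& t.1.1 \in S, t.1.2 \in S, t.2.1 \in S & t.2.2 \in S].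

Definition paths3 (S : {set G}) := [set t | path3 t & in3 S t].
Definition paths4 (S : {set G}) := [set t | path4 t & in4 S t].

(** Nonadjacent [u] and [v] have [w] as a middle vertex, so each further middle vertex adds 2 by
    [excess_level]. The middle edge of an induced path on 4 vertices is good and on no geodesic. *)
Lemma paths_excess u v :
  2 * #|[set z | (u, z, v) \in paths3 [set~ w]]| +
      #|[set e | ((u, e.1), (e.2, v)) \in paths4 [set~ w]]| <= excess u v.
Proof.
set A := [set z | _]; set E := [set e | _].
have [|nuv] := boolP ((u == v) || adj u v).
  move=> uv; have -> : A = set0.
    apply/setP => z; rewrite !inE /path3 /=; case/orP: uv => ->; rewrite ?andbF //.
  suff -> : E = set0 by rewrite !cards0.
  by apply/setP => e; rewrite !inE /path4 /=; case/orP: uv => ->; rewrite ?andbF.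
move: nuv; rewrite negb_or => /andP[uv nuv].
have [uw|uw] := eqVneq u w; first by rewrite uw dom // -uw eq_sym in nuv.
have [vw|vw] := eqVneq v w; first by rewrite vw adj_sym dom in nuv.
have duv : dist u v = 2.
  by apply: (dist_common uv nuv (dom uw) (dom vw)).
have := @excess_level u v 1; rewrite duv => /(_ isT).
have : #|E| <= #|nongeo u v|.
  apply: subset_leq_card; apply/subsetP => -[a b].
  rewrite !inE /path4 /path3 /= -!andbA => /and5P[ub nub ua ab] /and5P[av nav _ bv _].
  have := adj_dist1 ua; have := adj_dist1 bv; have := nadj_dist ub nub.
  by have := nadj_dist av nav; rewrite ab; dlia distC.
have : #|A|.+1 <= #|level u v 1|.
  have wA : w \notin A by rewrite !inE /in3 /= !inE eqxx /= !andbF.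
  have -> : #|A|.+1 = #|w |: A| by rewrite cardsU1 wA.
  apply: subset_leq_card; apply/subsetP => a; rewrite !inE => /orP[/eqP->|].
    by have := adj_dist1 (dom uw); have := adj_dist1 (dom vw); dlia distC.
  rewrite /path3 /= -!andbA => /and5P[_ _ ua av _].
  by have := adj_dist1 ua; have := adj_dist1 av; dlia distC.
move: (#|level _ _ _|) (#|nongeo _ _|) (#|A|) (#|E|) => i j k l; dlia distC.
Qed.

(** Paths are counted in both directions, so an undirected path contributes 4 if it has 3 vertices
    and 2 if it has 4. *)
Definition weight (S : {set G}) := 2 * #|paths3 S| + #|paths4 S|.

Lemma weight_le_total : weight [set~ w] <= total_excess G.
Proof.
have card_pair (T U : finType) (P : {set T * U}) :
    #|P| = \sum_(r : T) #|[set s | (r, s) \in P]|.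
  rewrite -sum1_card (eq_bigr (fun r : T => \sum_(s in [set s | (r, s) \in P]) 1)); last first.
    by move=> r _; rewrite sum1_card.
  by rewrite pair_big_dep /=; apply: eq_big => [[r s]|//]; rewrite /= inE.
have card_fst (P : {set G * G * G}) :
    #|P| = \sum_u \sum_v #|[set z | (u, z, v) \in P]|.
  rewrite card_pair (eq_bigr (fun p => #|[set v | (p.1, p.2, v) \in P]|)) => [|[] //].
  rewrite -(pair_bigA _ (fun u z => #|[set v | (u, z, v) \in P]|)) /=.
  apply: eq_bigr => u _.
  transitivity (\sum_z \sum_v ((u, z, v) \in P : nat)).
    by apply: eq_bigr => z _; rewrite -sum1dep_card big_mkcond.
  by rewrite exchange_big; apply: eq_bigr => v _; rewrite -sum1dep_card [RHS]big_mkcond.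
have card_snd (P : {set (G * G) * (G * G)}) :
    #|P| = \sum_u \sum_v #|[set e | ((u, e.1), (e.2, v)) \in P]|.
  (* Regroups a path into its two ends and its middle edge. *)
  pose h (t : (G * G) * (G * G)) := ((t.1.1, t.2.2), (t.1.2, t.2.1)).
  have hinj : injective h by move=> [[? ?] [? ?]] [[? ?] [? ?]] [-> -> -> ->].
  rewrite -(card_imset _ hinj) card_pair /=.
  rewrite (eq_bigr (fun p => #|[set e | ((p.1, p.2), e) \in h @: P]|)) => [|[] //].
  rewrite -(pair_bigA _ (fun u v => #|[set e | ((u, v), e) \in h @: P]|)) /=.
  apply: eq_bigr => u _; apply: eq_bigr => v _; apply: eq_card => -[a b].
  by rewrite !inE -[(u, v, (a, b))]/(h ((u, a), (b, v))) mem_imset.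
rewrite /weight card_fst card_snd big_distrr -big_split; apply: leq_sum => u _.
by rewrite big_distrr -big_split; apply: leq_sum => v _; exact: paths_excess.
Qed.

(** Connectedness of the subgraph on [S] in terms of cuts. *)
Definition connS (S : {set G}) := forall (X : {set G}) u v,
  u \in S -> u \in X -> v \in S -> v \notin X ->
  exists a b, [/\ a \in S :&: X, b \in S :\: X & adj a b].

Lemma connS1 c : connS [set c].
Proof. by move=> X u v /set1P-> cX /set1P->; rewrite cX. Qed.

Lemma connS_add S y s : connS S -> s \in S -> adj y s -> connS (y |: S).
Proof.
move=> cS sS ys X u v; rewrite !in_setU1.
have lift u' v' : u' \in S -> u' \in X -> v' \in S -> v' \notin X ->
    exists a b, [/\ a \in (y |: S) :&: X, b \in (y |: S) :\: X & adj a b].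
  move=> uS uX vS vX; have [a [b [+ + ab]]] := cS X u' v' uS uX vS vX.
  rewrite !inE => /andP[aS aX] /andP[bX bS]; exists a, b; split=> //.
    by rewrite !inE aS orbT.
  by rewrite !inE bS bX orbT.
case/orP => [/eqP->|uS] uX /orP[/eqP->|vS] vX; first by rewrite uX in vX.
- have [sX|sX] := boolP (s \in X); first exact: lift sS sX vS vX.
  by exists y, s; rewrite !inE eqxx uX sX sS orbT.
- have [sX|sX] := boolP (s \in X); last exact: lift uS uX sS sX.
  by exists s, y; rewrite !inE eqxx sX sS vX orbT adj_sym.
exact: lift uS uX vS vX.
Qed.

(* [k] bounds from below the weight collected inside the connected set [S]. *)
Definition stage (S : {set G}) (k : nat) := [/\ connS S, w \notin S & k <= weight S].

Lemma stage1 c : c != w -> stage [set c] 0.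
Proof. by move=> cw; split=> //; [exact: connS1 | rewrite inE eq_sym]. Qed.

Let rev3 (t : G * G * G) : G * G * G := (t.2, t.1.2, t.1.1).
Let rev4 (t : (G * G) * (G * G)) : (G * G) * (G * G) := ((t.2.2, t.2.1), (t.1.2, t.1.1)).

Lemma path3_rev t : path3 (rev3 t) = path3 t.
Proof.
case: t => [[u z] v]; rewrite /path3 /= eq_sym (adj_sym v u) (adj_sym v z) (adj_sym z u).
by rewrite [adj z v && _]andbC.
Qed.

Lemma path4_rev t : path4 (rev4 t) = path4 t.
Proof.
case: t => [[a b] [c d]]; rewrite /path4 /= -[(d, c, b)]/(rev3 (b, c, d)).
rewrite -[(c, b, a)]/(rev3 (a, b, c)) !path3_rev eq_sym (adj_sym d a).
by rewrite andbCA.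
Qed.

(** The listed paths are distinct up to reversal and not contained in [S], so they add to the old
    ones with weights 4 and 2. *)
Lemma stage_add S k y s (l3 : seq (G * G * G)) (l4 : seq ((G * G) * (G * G))) :
  stage S k -> y != w -> y \notin S -> s \in S -> adj y s ->
  uniq (l3 ++ map rev3 l3) -> uniq (l4 ++ map rev4 l4) ->
  all (fun t => [&& path3 t, in3 (y |: S) t & ~~ in3 S t]) l3 ->
  all (fun t => [&& path4 t, in4 (y |: S) t & ~~ in4 S t]) l4 ->
  stage (y |: S) (k + 4 * size l3 + 2 * size l4).
Proof.
case=> cS wS kS yw yS sS ys u3 u4 a3 a4; split.
- exact: connS_add sS ys.
- by rewrite in_setU1 negb_or wS eq_sym yw.
have sub t : t \in S -> t \in y |: S by move=> tS; rewrite in_setU1 tS orbT.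
have h3 : #|paths3 S| + 2 * size l3 <= #|paths3 (y |: S)|.
  have -> : 2 * size l3 = #|[set t in l3 ++ map rev3 l3]|.
    by rewrite cardsE (card_uniqP u3) size_cat size_map addnn mul2n.
  rewrite -cardsUI (_ : _ :&: _ = set0) ?cards0 ?addn0.
    apply: subset_leq_card; apply/subsetP => t; rewrite !inE mem_cat.
    case/or3P => [/andP[-> /and3P[h1 h2 h3]]|/(allP a3)/and3P[-> -> _]//|].
      by rewrite /in3 !sub.
    case/mapP => r /(allP a3)/and3P[h1 /and3P[h2 h3 h4] _] ->.
    by rewrite path3_rev h1 /in3 /= h2 h3 h4.
  apply/setP => t; rewrite !inE mem_cat; apply/negP => /andP[/andP[_ tS]].
  case/orP => [/(allP a3)/and3P[_ _]|/mapP[r /(allP a3)/and3P[_ _ rS] E]]; first by rewrite tS.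
  by case/negP: rS; move: tS; rewrite E /in3 /= => /and3P[-> -> ->].
have h4 : #|paths4 S| + 2 * size l4 <= #|paths4 (y |: S)|.
  have -> : 2 * size l4 = #|[set t in l4 ++ map rev4 l4]|.
    by rewrite cardsE (card_uniqP u4) size_cat size_map addnn mul2n.
  rewrite -cardsUI (_ : _ :&: _ = set0) ?cards0 ?addn0.
    apply: subset_leq_card; apply/subsetP => t; rewrite !inE mem_cat.
    case/or3P => [/andP[-> /and4P[h1 h2 h3' h4]]|/(allP a4)/and3P[-> -> _]//|].
      by rewrite /in4 !sub.
    case/mapP => r /(allP a4)/and3P[h1 /and4P[h2 h3' h4 h5] _] ->.
    by rewrite path4_rev h1 /in4 /= h2 h3' h4 h5.
  apply/setP => t; rewrite !inE mem_cat; apply/negP => /andP[/andP[_ tS]].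
  case/orP => [/(allP a4)/and3P[_ _]|/mapP[r /(allP a4)/and3P[_ _ rS] E]]; first by rewrite tS.
  by case/negP: rS; move: tS; rewrite E /in4 /= => /and4P[-> -> -> ->].
by move: kS h3 h4; rewrite /weight; move: #|paths3 S| #|paths3 _| #|paths4 S| #|paths4 _|; dlia distC.
Qed.

Definition has_vertex y (t : G * G * G) := [|| t.1.1 == y, t.1.2 == y | t.2 == y].

Lemma has_vertex_notin (S : {set G}) y t : y \notin S -> has_vertex y t -> ~~ in3 S t.
Proof.
by move=> yS /or3P[]/eqP E; rewrite /in3 E (negPf yS) ?andbF.
Qed.

Lemma stage_gain S k y s t1 :
  stage S k -> y != w -> y \notin S -> s \in S -> adj y s ->
  path3 t1 -> in3 (y |: S) t1 -> has_vertex y t1 -> stage (y |: S) (k + 4).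
Proof.
move=> st yw yS sS ys p1 i1 h1.
rewrite -[_ + 4]addn0; apply: (@stage_add S k y s [:: t1] [::]) => //.
  rewrite /= inE andbT; case: t1 p1 {i1 h1} => [[u z] v] /and4P[/= uv _ _ _].
  by rewrite /rev3 /= !xpair_eqE (negPf uv).
by rewrite /= p1 i1 (has_vertex_notin yS h1).
Qed.

Lemma stage_gain2 S k y s t1 t2 :
  stage S k -> y != w -> y \notin S -> s \in S -> adj y s ->
  path3 t1 -> path3 t2 -> in3 (y |: S) t1 && in3 (y |: S) t2 ->
  has_vertex y t1 && has_vertex y t2 -> uniq [:: t1; t2; rev3 t1; rev3 t2] ->
  stage (y |: S) (k + 8).
Proof.
move=> st yw yS sS ys p1 p2 /andP[i1 i2] /andP[h1 h2] u12.
rewrite -[_ + 8]addn0; apply: (@stage_add S k y s [:: t1; t2] [::]) => //.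
by rewrite /= p1 p2 i1 i2 !(has_vertex_notin yS).
Qed.

Lemma stage_gain34 S k y s u z v c d :
  stage S k -> y != w -> y \notin S -> s \in S -> adj y s ->
  path3 (u, z, v) -> in3 (y |: S) (u, z, v) && has_vertex y (u, z, v) ->
  path4 ((y, s), (c, d)) -> (c \in S) && (d \in S) ->
  stage (y |: S) (k + 6).
Proof.
move=> st yw yS sS ys p1 /andP[i1 h1] p4 /andP[cS dS].
rewrite -[6]/(4 + 2) addnA.
apply: (@stage_add S k y s [:: (u, z, v)] [:: ((y, s), (c, d))]) => //=.
- by case/and4P: p1 => /= uv _ _ _; rewrite inE /rev3 /= !xpair_eqE (negPf uv).
- by case/and4P: p4 => /= _ _ yd _; rewrite inE /rev4 /= !xpair_eqE (negPf yd).
- by rewrite p1 i1 (has_vertex_notin yS h1).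
by rewrite p4 /in4 /= (negPf yS) !inE eqxx sS cS dS !orbT.
Qed.

Lemma stage_exit S k u v : stage S k -> u \in S -> v \notin S -> v != w ->
  exists y s, [/\ y != w, y \notin S, s \in S & adj y s].
Proof.
case=> cS wS _ uS vS vw.
have [||||s [y [sS yS sw yw sy]]] := @exit_avoiding w S u v; rewrite //.
  by apply: contraNneq wS => <-.
by exists y, s; rewrite adj_sym.
Qed.

(** A weight of 4|S| - 4 suffices: every further vertex gains 4, and when [S] has grown to all n - 1
    vertices other than [w] the weight is 4n - 8. *)
Lemma stage_total S k u v : stage S k -> u \in S -> v \in S -> u != v -> ~~ adj u v ->
  4 * #|S| <= k + 4 -> 4 * gorder G <= total_excess G + 8.
Proof.
move=> st uS vS uv nuv.
move Em: #|[set~ w] :\: S| => m; elim: m S k Em st uS vS => [|m IH] S k Em st uS vS kS.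
  have [_ wS kw] := st.
  have ES : S = [set~ w].
    apply/eqP; rewrite eqEsubset -[X in _ && X]setD_eq0 -cards_eq0 Em eqxx andbT.
    by apply/subsetP => t tS; rewrite !inE; apply: contraNneq wS => <-.
  have := weight_le_total; rewrite -ES; have := cardsC1 w; rewrite -ES -/(gorder G).
  by move: kw kS; move: #|S| => i; dlia distC.
have [t tm] : exists t, t \in [set~ w] :\: S by apply/card_gt0P; rewrite Em.
move: tm; rewrite !inE => /andP[tS tw].
have [y [s [yw yS sS ys]]] := stage_exit st uS tS tw.
have Em' : #|[set~ w] :\: (y |: S)| = m.
  have := cardsD1 y ([set~ w] :\: S); rewrite Em !inE yS yw /= => -[->].
  by apply: eq_card => r; rewrite !inE negb_or -!andbA.
(* If [y] is adjacent to all of [S], the path is [u y v]. Otherwise connectedness of [S] gives an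
   edge [ab] with only [a] adjacent to [y], and the path is [y a b]. *)
have [t1 [p1 i1 h1]] : exists t1, [/\ path3 t1, in3 (y |: S) t1 & has_vertex y t1].
  have [/allP yall|] := boolP (all (adj y) (enum S)).
    have yS' r : r \in S -> adj y r by move=> rS; apply: yall; rewrite mem_enum.
    exists (u, y, v); rewrite /path3 /in3 /has_vertex /= uv nuv (adj_sym u) !yS' //.
    by rewrite !inE uS vS eqxx !orbT.
  case/allPn => r; rewrite mem_enum => rS nyr; have [cS _ _] := st.
  have [||||a [b [+ + ab]]] := cS [set q | adj y q] s r; rewrite ?inE //.
  move=> /andP[aS ya] /andP[nyb bS].
  exists (y, a, b); rewrite /path3 /in3 /has_vertex /= ya nyb ab !inE aS bS eqxx !orbT.
  by split=> //; rewrite !andbT; apply: contraNneq yS => ->.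
have st' := stage_gain st yw yS sS ys p1 i1 h1.
apply: (IH _ _ Em' st'); rewrite ?in_setU1 ?uS ?vS ?orbT //.
by rewrite cardsU1 yS; move: kS; move: #|S| => i; dlia distC.
Qed.

Hypothesis G6 : 6 <= gorder G.

Lemma stage_next S k (l : seq G) u : stage S k -> S = [set s in l] -> size l <= 4 ->
  u \in S -> exists y s, [/\ y != w, y \notin S, s \in S & adj y s].
Proof.
move=> st ES l4 uS.
have [v vl] : exists v, v \in ~: [set s in w :: l].
  apply/card_gt0P; have := cardsC [set s in w :: l]; rewrite -/(gorder G) cardsE.
  have := card_size (w :: l); move: l4; rewrite /=.
  by move: #|_| #|_| (size l) => i j m; dlia distC.
move: vl; rewrite !inE negb_or => /andP[vw vl].
by apply: stage_exit st uS _ vw; rewrite ES inE.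
Qed.

Ltac vtx := first [done | by rewrite adj_sym | by rewrite eq_sym].
Ltac tpath3 := by rewrite /path3 /=; apply/and4P; split; vtx.
Ltac tpath4 := rewrite /path4 /=; apply/and4P; split; [tpath3 | tpath3 | vtx | vtx].
Ltac tmem := by rewrite /in3 /has_vertex /= ?inE ?eqxx ?orbT.
Ltac tuniq := by rewrite /= ?inE /rev3 /= ?xpair_eqE; neq_rw.

Lemma stage_path3 a c b : a != w -> c != w -> b != w ->
  a != b -> ~~ adj a b -> adj a c -> adj c b -> stage (b |: (a |: [set c])) 4.
Proof.
move=> aw cw bw ab nab ac cb; have nac := adj_neq ac; have ncb := adj_neq cb.
have sc : stage (a |: [set c]) (0 + 4 * 0 + 2 * 0).
  by apply: (@stage_add [set c] 0 a c [::] [::] (stage1 cw)) => //; rewrite inE ?eqxx.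
apply: (@stage_gain _ 0 b c (a, c, b) sc) => //.
- by rewrite !inE negb_or (eq_sym b a) ab eq_sym ncb.
- by rewrite !inE eqxx orbT.
- by rewrite adj_sym.
- tpath3.
- tmem.
tmem.
Qed.

Ltac use2 g2 t1 t2 := apply: (g2 t1 t2); [tpath3 | tpath3 | tmem | tmem | tuniq].

Ltac use34 g34 s t e f := apply: (g34 s t.1.1 t.1.2 t.2 e f);
  [done | vtx | tpath3 | tmem | tpath4 | by rewrite !inE !eqxx !orbT].

(** The path itself has weight 4 + 4 + 2 = 10, and five vertices need 16. So the next vertex [y] has
    to gain 6: two induced paths on 3 vertices, or one on 3 and one on 4. *)
Lemma path4_total a b c d : a != w -> b != w -> c != w -> d != w ->
  path4 ((a, b), (c, d)) -> 4 * gorder G <= total_excess G + 8.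
Proof.
move=> aw bw cw dw p4; have := p4; rewrite /path4 /path3 /=.
case/and4P=> /and4P[nac ac ab bc] /and4P[nbd bd _ cd] nad ad.
have [nab nbc ncd] := And3 (adj_neq ab) (adj_neq bc) (adj_neq cd).
have st3 := stage_path3 aw bw cw nac ac ab bc.
have dS3 : d \notin c |: (a |: [set b]).
  by rewrite !inE !negb_or (eq_sym d c) ncd (eq_sym d a) nad eq_sym nbd.
have st : stage (d |: (c |: (a |: [set b]))) 10.
  rewrite -[10]/(4 + 6); apply: (@stage_gain34 _ 4 d c b c d b a st3) => //.
  - by rewrite !inE eqxx.
  - by rewrite adj_sym.
  - tpath3.
  - tmem.
  - rewrite /path4 /=; apply/and4P; split; [tpath3|tpath3|vtx|vtx].
  by rewrite !inE !eqxx !orbT.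
have cardS : #|d |: (c |: (a |: [set b]))| = 4.
  rewrite !cardsU1 cards1 dS3 !inE (eq_sym c a) (negPf nac) (eq_sym c b) (negPf nbc).
  by rewrite (negPf nab).
set S := d |: _ in st cardS.
have [|||y [s [yw yS sS ys]]] := @stage_next S 10 [:: d; c; a; b] d st.
- by apply/setP => r; rewrite !inE.
- by [].
- by rewrite !inE eqxx.
have aS : a \in S by rewrite !inE eqxx ?orbT.
have bS : b \in S by rewrite !inE eqxx ?orbT.
have cS : c \in S by rewrite !inE eqxx ?orbT.
have dS : d \in S by rewrite !inE eqxx ?orbT.
have := yS; rewrite !inE !negb_or => /and4P[yd yc ya yb].
have fin k : 16 <= k -> stage (y |: S) k -> 4 * gorder G <= total_excess G + 8.
  have [aS' cS'] : a \in y |: S /\ c \in y |: S by split; apply/setU1P; right.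
  move=> k16 st'; apply: (@stage_total (y |: S) k a c st') => //.
  by rewrite cardsU1 yS cardS; move: k16; clear; lia.
have g2 t1 t2 : path3 t1 -> path3 t2 -> in3 (y |: S) t1 && in3 (y |: S) t2 ->
    has_vertex y t1 && has_vertex y t2 -> uniq [:: t1; t2; rev3 t1; rev3 t2] ->
    4 * gorder G <= total_excess G + 8.
  move=> p1 p2 i12 h12 u12; apply: (fin 18) => //.
  exact: (@stage_gain2 S 10 y s t1 t2 st).
have g34 s' u z v e f : s' \in S -> adj y s' -> path3 (u, z, v) ->
    in3 (y |: S) (u, z, v) && has_vertex y (u, z, v) ->
    path4 ((y, s'), (e, f)) -> (e \in S) && (f \in S) ->
    4 * gorder G <= total_excess G + 8.
  move=> sS' ys' p1 ih p4' ef; apply: (fin 16) => //.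
  exact: (@stage_gain34 S 10 y s' u z v e f st).
clear st3.
(* Sixteen neighbourhoods of [y]; the last, empty one contradicts the choice of [y]. *)
have [ya1|ya0] := boolP (adj y a); have [yb1|yb0] := boolP (adj y b);
  have [yc1|yc0] := boolP (adj y c); have [yd1|yd0] := boolP (adj y d).
- use2 g2 (a, y, c) (a, y, d).
- use2 g2 (a, y, c) (y, c, d).
- use2 g2 (a, y, d) (b, y, d).
- use34 g34 b (y, b, c) c d.
- use2 g2 (a, y, d) (a, y, c).
- use2 g2 (a, y, c) (y, c, d).
- use2 g2 (a, y, d) (y, a, b).
- use34 g34 a (y, a, b) b c.
- use2 g2 (b, y, d) (y, b, a).
- use2 g2 (y, b, a) (y, c, d).
- use2 g2 (b, y, d) (y, b, a).
- use2 g2 (y, b, a) (y, b, c).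
- use34 g34 c (y, c, b) b a.
- use2 g2 (y, c, b) (y, c, d).
- use34 g34 d (y, d, c) c b.
move: sS ys; rewrite !inE => /or4P[]/eqP->; 
  by rewrite ?(negPf ya0) ?(negPf yb0) ?(negPf yc0) ?(negPf yd0).
Qed.

Hypothesis hard : ~~ (4 * gorder G <= total_excess G + 8).

Lemma hard_path4 a b c d : a != w -> b != w -> c != w -> d != w ->
  ~~ path4 ((a, b), (c, d)).
Proof. by move=> *; apply: contraNN hard; apply: path4_total. Qed.

Lemma hard_stage S k u v : stage S k -> u \in S -> v \in S -> path3 (u, w, v) ->
  k + 4 < 4 * #|S|.
Proof.
move=> st uS vS /and4P[/= uv nuv _ _]; rewrite ltnNge; apply: contraNN hard.
exact: stage_total st uS vS uv nuv.
Qed.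

Section Path3.
Variables a c b : G.
Hypotheses (aw : a != w) (cw : c != w) (bw : b != w).
Hypotheses (nab : a != b) (ab : ~~ adj a b) (ac : adj a c) (cb : adj c b).

Let S3 := b |: (a |: [set c]).

Lemma card_S3 : #|S3| = 3.
Proof.
rewrite !cardsU1 cards1 !inE (eq_sym b a) (negPf nab) (eq_sym b c).
by rewrite (negPf (adj_neq cb)) (negPf (adj_neq ac)).
Qed.

Lemma in_S3 : [/\ a \in S3, b \in S3 & c \in S3].
Proof. by rewrite !inE !eqxx !orbT. Qed.

Lemma abw3 : path3 (a, w, b).
Proof. by rewrite /path3 /= nab ab (adj_sym a) !dom. Qed.

Lemma notin_S3 y : y \notin S3 -> [/\ y != a, y != b & y != c].
Proof. by rewrite !inE !negb_or => /and3P[]. Qed.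

(** The path [a c b] has weight 4, which is 4 below the requirement of [stage_total], and one new
    path per vertex keeps this deficit. A second new path at one step removes it, against [hard];
    [hard_gain_gain2] says the same one vertex later. *)
Lemma hard_gain2 y s t1 t2 : y != w -> y \notin S3 -> s \in S3 -> adj y s ->
  path3 t1 -> path3 t2 -> in3 (y |: S3) t1 && in3 (y |: S3) t2 ->
  has_vertex y t1 && has_vertex y t2 -> uniq [:: t1; t2; rev3 t1; rev3 t2] -> False.
Proof.
move=> yw yS sS ys p1 p2 i12 h12 u12; have [aS bS cS] := in_S3.
have st := @stage_gain2 S3 4 y s t1 t2 (stage_path3 aw cw bw nab ab ac cb) yw yS sS ys p1 p2 i12 h12 u12.
have := hard_stage st (setU1r _ aS) (setU1r _ bS) abw3.
by rewrite cardsU1 yS card_S3.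
Qed.

Lemma hard_gain_gain2 y t y' s t1 t2 : y != w -> y \notin S3 -> adj y c ->
  path3 t -> in3 (y |: S3) t -> has_vertex y t ->
  y' != w -> y' \notin S3 -> y' != y -> s \in y |: S3 -> adj y' s ->
  path3 t1 -> path3 t2 -> in3 (y' |: (y |: S3)) t1 && in3 (y' |: (y |: S3)) t2 ->
  has_vertex y' t1 && has_vertex y' t2 -> uniq [:: t1; t2; rev3 t1; rev3 t2] -> False.
Proof.
move=> yw yS yc p i h y'w y'S y'y sS y's p1 p2 i12 h12 u12; have [aS bS cS] := in_S3.
have st := stage_gain (stage_path3 aw cw bw nab ab ac cb) yw yS cS yc p i h.
have y'S4 : y' \notin y |: S3 by rewrite in_setU1 negb_or y'y.
have st' := @stage_gain2 (y |: S3) 8 y' s t1 t2 st y'w y'S4 sS y's p1 p2 i12 h12 u12.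
have := hard_stage st' (setU1r _ (setU1r _ aS)) (setU1r _ (setU1r _ bS)) abw3.
by rewrite cardsU1 y'S4 cardsU1 yS card_S3.
Qed.

Lemma near_type y : y != w -> y \notin S3 -> [|| adj y a, adj y b | adj y c] ->
  adj y c && (adj y a || adj y b).
Proof.
move=> yw yS ny; have [ya yb yc] := notin_S3 yS; have [aS bS cS] := in_S3.
have [nac ncb] := conj (adj_neq ac) (adj_neq cb).
have [yc1|yc0] := boolP (adj y c); have [ya1|ya0] := boolP (adj y a);
  have [yb1|yb0] := boolP (adj y b) => //=; exfalso.
- apply: (@hard_gain2 y c (y, c, a) (y, c, b)) => //; [tpath3|tpath3|tmem|tmem|tuniq].
- apply: (@hard_gain2 y a (a, y, b) (y, a, c)) => //; [tpath3|tpath3|tmem|tmem|tuniq].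
- by have := hard_path4 yw aw cw bw; apply/negP; rewrite negbK; tpath4.
- by have := hard_path4 yw bw cw aw; apply/negP; rewrite negbK; tpath4.
by move: ny; rewrite (negPf ya0) (negPf yb0) (negPf yc0).
Qed.

(** Otherwise, by 2-connectedness, some such vertex [p] has a neighbour [q] that is itself adjacent
    to the path. By [near_type] this yields an induced path on 4 vertices or two new paths at
    once. *)
Lemma all_near y : y != w -> y \notin S3 -> [|| adj y a, adj y b | adj y c].
Proof.
move=> yw yS; apply: contraTT isT => ny; have [aS bS cS] := in_S3.
pose X := [set t | [&& t != w, t \notin S3 & ~~ [|| adj t a, adj t b | adj t c]]].
have [||||p [q [pX qX pw qw pq]]] := @exit_avoiding w X y c.
- by rewrite inE yw yS.
- by rewrite inE cS andbF.
- by [].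
- by [].
move: pX; rewrite inE => /and3P[_ pS]; rewrite !negb_or => /and3P[pa pb pc].
have qS : q \notin S3.
  apply/negP; rewrite !inE => /or3P[]/eqP E; rewrite E in pq.
  - by rewrite pq in pb.
  - by rewrite pq in pa.
  by rewrite pq in pc.
have qn : [|| adj q a, adj q b | adj q c] by move: qX; rewrite inE qw qS negbK.
have [pa' pb' pc'] := notin_S3 pS; have [qa qb qc] := notin_S3 qS.
have [nac ncb] := conj (adj_neq ac) (adj_neq cb); have npq := adj_neq pq.
exfalso; case/andP: (near_type qw qS qn) => qc1.
have [qa1|qa0] := boolP (adj q a); have [qb1|qb0] := boolP (adj q b) => // _.
- apply: (@hard_gain_gain2 q (a, q, b) p q (p, q, a) (p, q, b)) => //;
    [tpath3|tmem|tmem|by rewrite !inE eqxx|tpath3|tpath3|tmem|tmem|tuniq].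
- by have := hard_path4 pw qw cw bw; apply/negP; rewrite negbK; tpath4.
by have := hard_path4 pw qw cw aw; apply/negP; rewrite negbK; tpath4.
Qed.

Lemma third_vertex y : y != w -> y \notin S3 -> adj y c && (adj y a || adj y b).
Proof. by move=> yw yS; apply: near_type => //; apply: all_near. Qed.

(** One vertex missing [b] forces every other to miss it too and to be adjacent to the first;
    anything else creates an induced path on 4 vertices or two new paths at one step. *)
Lemma pair_left y y' : y != w -> y \notin S3 -> ~~ adj y b ->
  y' != w -> y' \notin S3 -> y' != y -> adj y' y && ~~ adj y' b.
Proof.
move=> yw yS yb0 y'w y'S y'y; have [ya yb yc] := notin_S3 yS.
have [y'a y'b y'c] := notin_S3 y'S; have [aS bS cS] := in_S3.
have [nac ncb] := conj (adj_neq ac) (adj_neq cb).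
have /andP[yc1] := third_vertex yw yS; rewrite (negPf yb0) orbF => ya1.
have /andP[y'c1 y'ab] := third_vertex y'w y'S.
have [y'b1|y'b0] := boolP (adj y' b).
  exfalso; have [y'a1|y'a0] := boolP (adj y' a).
    have [yy1|yy0] := boolP (adj y' y).
      apply: (@hard_gain_gain2 y (y, c, b) y' c (a, y', b) (y, y', b)) => //;
        [tpath3|tmem|tmem|by rewrite !inE eqxx !orbT|tpath3|tpath3|tmem|tmem|tuniq].
    apply: (@hard_gain_gain2 y (y, c, b) y' c (y, a, y') (y, c, y')) => //;
      [tpath3|tmem|tmem|by rewrite !inE eqxx !orbT|tpath3|tpath3|tmem|tmem|tuniq].
  have [yy1|yy0] := boolP (adj y' y).
    by have := hard_path4 aw yw y'w bw; apply/negP; rewrite negbK; tpath4.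
  apply: (@hard_gain_gain2 y (y, c, b) y' c (a, c, y') (y, c, y')) => //;
    [tpath3|tmem|tmem|by rewrite !inE eqxx !orbT|tpath3|tpath3|tmem|tmem|tuniq].
rewrite andbT; have [//|yy0] := boolP (adj y' y).
rewrite (negPf y'b0) orbF in y'ab; exfalso.
apply: (@hard_gain_gain2 y (y, c, b) y' c (y, a, y') (y, c, y')) => //;
  [tpath3|tmem|tmem|by rewrite !inE eqxx !orbT|tpath3|tpath3|tmem|tmem|tuniq].
Qed.

Lemma pair_both y y' : y != w -> y \notin S3 -> adj y a -> adj y b ->
  y' != w -> y' \notin S3 -> y' != y -> adj y' a -> adj y' b -> adj y' y.
Proof.
move=> yw yS ya1 yb1 y'w y'S y'y y'a1 y'b1; have [ya yb yc] := notin_S3 yS.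
have [y'a y'b y'c] := notin_S3 y'S; have [aS bS cS] := in_S3.
have [nac ncb] := conj (adj_neq ac) (adj_neq cb).
have /andP[yc1 _] := third_vertex yw yS; have /andP[y'c1 _] := third_vertex y'w y'S.
apply: contraTT isT => yy0; exfalso.
apply: (@hard_gain_gain2 y (a, y, b) y' c (y, a, y') (y, b, y')) => //;
  [tpath3|tmem|tmem|by rewrite !inE eqxx !orbT|tpath3|tpath3|tmem|tmem|tuniq].
Qed.

End Path3.

(** The case that leads to $K_n^2$, with [b] as the added vertex. *)
Lemma left_type_exceptional a c b y : a != w -> c != w -> b != w ->
  a != b -> ~~ adj a b -> adj a c -> adj c b ->
  y != w -> y \notin b |: (a |: [set c]) -> ~~ adj y b ->
  (forall u v, u != b -> v != b -> u != v -> adj u v) /\ [set v | adj b v] = [set c; w].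
Proof.
move=> aw cw bw nab ab ac cb yw yS yb0.
have type v : v != w -> v \notin b |: (a |: [set c]) -> [/\ adj v c, adj v a & ~~ adj v b].
  move=> vw vS; have vb0 : ~~ adj v b.
    have [->//|vy] := eqVneq v y.
    by have /andP[] := pair_left aw cw bw nab ab ac cb yw yS yb0 vw vS vy.
  have /andP[vc] := third_vertex aw cw bw nab ab ac cb vw vS.
  by rewrite (negPf vb0) orbF.
have dom' u : u != w -> adj u w by move=> uw; rewrite adj_sym dom.
split=> [u v ub vb uv|]; last first.
  apply/setP => v; rewrite !inE; have [->|vw] := eqVneq v w; first by rewrite dom' ?orbT.
  rewrite orbF; have [->|vc] := eqVneq v c; first by rewrite adj_sym cb.
  have [->|va] := eqVneq v a; first by rewrite adj_sym (negPf ab).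
  have [->|vb] := eqVneq v b; first by rewrite adj_irr.
  apply/negbTE; rewrite adj_sym; have [] // := type v vw.
  by rewrite !inE !negb_or vb va.
have [Eu|uw] := eqVneq u w; first by rewrite Eu dom // -Eu eq_sym.
have [Ev|vw] := eqVneq v w; first by rewrite Ev dom'.
have cls r : r != b -> r != w -> [\/ r = a, r = c | r \notin b |: (a |: [set c])].
  move=> rb rw; have [->|ra] := eqVneq r a; first exact: Or31.
  have [->|rc] := eqVneq r c; first exact: Or32.
  by apply: Or33; rewrite !inE !negb_or rb ra.
case: (cls u ub uw) (cls v vb vw) => [Eu|Eu|uS] [Ev|Ev|vS].
- by rewrite Eu Ev eqxx in uv.
- by rewrite Eu Ev.
- by rewrite Eu adj_sym; case: (type v vw vS).
- by rewrite Eu Ev adj_sym.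
- by rewrite Eu Ev eqxx in uv.
- by rewrite Eu adj_sym; case: (type v vw vS).
- by rewrite Ev; case: (type u uw uS).
- by rewrite Ev; case: (type u uw uS).
have [_ _ vb0] := type v vw vS.
by case/andP: (pair_left aw cw bw nab ab ac cb vw vS vb0 uw uS uv).
Qed.

(** The case that leads to $K_n^{n-2}$: [a] is the only non-neighbour of [b]. *)
Lemma both_type_exceptional a c b : a != w -> c != w -> b != w ->
  a != b -> ~~ adj a b -> adj a c -> adj c b ->
  (forall y, y != w -> y \notin b |: (a |: [set c]) -> adj y a && adj y b) ->
  (forall u v, u != b -> v != b -> u != v -> adj u v) /\
  [set v | adj b v] = ~: [set a; b].
Proof.
move=> aw cw bw nab ab ac cb both.
have type v : v != w -> v \notin b |: (a |: [set c]) -> [/\ adj v c, adj v a & adj v b].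
  move=> vw vS; have /andP[va vb] := both v vw vS.
  by have /andP[] := third_vertex aw cw bw nab ab ac cb vw vS.
have dom' u : u != w -> adj u w by move=> uw; rewrite adj_sym dom.
split=> [u v ub vb uv|]; last first.
  apply/setP => v; rewrite !inE negb_or; have [->|vw] := eqVneq v w.
    by rewrite dom' // (eq_sym w) aw eq_sym bw.
  have [->|va] := eqVneq v a; first by rewrite adj_sym (negPf ab).
  have [->|vb] := eqVneq v b; first by rewrite adj_irr.
  have [->|vc] := eqVneq v c; first by rewrite adj_sym cb.
  by rewrite adj_sym; have [] // := type v vw; rewrite !inE !negb_or vb va.
have [Eu|uw] := eqVneq u w; first by rewrite Eu dom // -Eu eq_sym.
have [Ev|vw] := eqVneq v w; first by rewrite Ev dom'.
have cls r : r != b -> r != w -> [\/ r = a, r = c | r \notin b |: (a |: [set c])].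
  move=> rb rw; have [->|ra] := eqVneq r a; first exact: Or31.
  have [->|rc] := eqVneq r c; first exact: Or32.
  by apply: Or33; rewrite !inE !negb_or rb ra.
case: (cls u ub uw) (cls v vb vw) => [Eu|Eu|uS] [Ev|Ev|vS].
- by rewrite Eu Ev eqxx in uv.
- by rewrite Eu Ev.
- by rewrite Eu adj_sym; case: (type v vw vS).
- by rewrite Eu Ev adj_sym.
- by rewrite Eu Ev eqxx in uv.
- by rewrite Eu adj_sym; case: (type v vw vS).
- by rewrite Ev; case: (type u uw uS).
- by rewrite Ev; case: (type u uw uS).
have [_ va vb1] := type v vw vS; have [_ ua ub1] := type u uw uS.
exact: (pair_both aw cw bw nab ab ac cb vw vS va vb1 uw uS uv ua ub1).
Qed.

Lemma hard_exceptional u v : u != v -> ~~ adj u v ->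
  exists s, (forall p q, p != s -> q != s -> p != q -> adj p q) /\
    (#|[set y | adj s y]| = 2 \/ #|[set y | adj s y]| = gorder G - 2).
Proof.
move=> uv nuv.
have [Eu|uw] := eqVneq u w; first by move: nuv; rewrite Eu dom // -Eu eq_sym.
have [Ev|vw] := eqVneq v w; first by move: nuv; rewrite Ev adj_sym dom // -Ev.
(* An edge leaving the closed neighbourhood of [u] and avoiding [w] completes an induced path
   [u c b]. *)
pose X := [set r | (r == u) || adj u r].
have [||||c [b [cX bX cw bw cb]]] := @exit_avoiding w X u v; rewrite ?inE ?eqxx //.
  by rewrite negb_or eq_sym uv.
move: bX cX; rewrite !inE negb_or => /andP[bu ub] /orP[/eqP Ec|uc].
  by rewrite -Ec cb in ub.
have nub : u != b by rewrite eq_sym.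
have bc : adj b c by rewrite adj_sym.
have cu : adj c u by rewrite adj_sym.
have bun : ~~ adj b u by rewrite adj_sym.
have swap : u |: (b |: [set c]) = b |: (u |: [set c]) by rewrite setUCA.
have card2 s p : s != p -> #|[set s; p]| = 2 by move=> sp; rewrite cards2 sp.
have [|/forall_inPn[y]] := boolP [forall y in ~: (w |: (b |: (u |: [set c]))), adj y u && adj y b].
  move=> /forall_inP both; exists b.
  have [|clique N] := both_type_exceptional uw cw bw nub ub uc cb.
    by move=> y yw yS; apply: both; rewrite in_setC in_setU1 negb_or yw.
  split=> //; right; rewrite N; have := cardsC [set u; b]; rewrite card2 // -/(gorder G).
  by move=> <-; rewrite addKn.
rewrite in_setC in_setU1 negb_or => /andP[yw yS].
(* The added vertex is the end of the path that [y] misses. *)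
rewrite negb_and => /orP[yu0|yb0].
  exists u; rewrite -swap in yS.
  have [clique N] := left_type_exceptional bw cw uw bu bun bc cu yw yS yu0.
  by split=> //; left; rewrite N card2.
exists b; have [clique N] := left_type_exceptional uw cw bw nub ub uc cb yw yS yb0.
by split=> //; left; rewrite N card2.
Qed.

End Dominated.

End Graph.

(** * Conclusion *)

Section InducedExcess.
Variables (G : sgraph) (Q : {set G}).
Hypothesis conn : forall u v : G, connect (@adj G) u v.
Hypothesis geodesic : forall u v, u \in Q -> v \in Q -> u != v ->
  exists2 q, q \in Q & adj u q /\ dist q v < dist u v.

Lemma excess_induced (u v : induced Q) : excess u v <= excess (val u) (val v).
Proof.
have := goodE conn (val u) (val v); have := goodE (induced_connect geodesic) u v.
rewrite -(dist_induced geodesic).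
suff : #|good u v| <= #|good (val u) (val v)| by move: #|_| #|_| => k l; lia.
pose f (e : induced Q * induced Q) := (val e.1, val e.2).
have injf : injective f.
  by move=> [a b] [c d] [E E']; congr (_, _); apply: val_inj.
rewrite -(card_imset _ injf); apply: subset_leq_card; apply/subsetP => e.
by case/imsetP => e'; rewrite !inE !(dist_induced geodesic) => ? ->.
Qed.

Lemma total_excess_induced : total_excess (induced Q) <= inner_excess Q.
Proof.
have E (F : G -> nat) : \sum_(u in Q) F u = \sum_(u : induced Q) F (val u).
  by rewrite big_sub.
rewrite /total_excess /inner_excess E; apply: leq_sum => u _.
by rewrite /excess_to E; apply: leq_sum => v _; exact: excess_induced.
Qed.


End InducedExcess.

(** The vertices other than [s] are numbered with the neighbours of [s] first, as [ext_complete_rel]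
    requires. *)
Lemma iso_ext_complete (G : sgraph) (s : G) :
  (forall u v, u != s -> v != s -> u != v -> adj u v) ->
  graph_iso G (ext_complete_graph #|G| #|[set y | adj s y]|).
Proof.
move=> clique; set N := [set y | adj s y]; set n := #|G|.
pose R := ~: (s |: N); pose l := enum N ++ enum R.
have mem_l y : (y \in l) = (y != s).
  rewrite mem_cat !mem_enum !inE negb_or.
  by case: eqP => [->|_] /=; rewrite ?adj_irr // orbN.
have ul : uniq l.
  rewrite cat_uniq !enum_uniq andbT /=; apply/hasPn => y; rewrite !mem_enum !inE negb_or.
  by case/andP.
have sl : size l = n.-1.
  have := card_uniqP ul; rewrite (eq_card mem_l) => <-.
  have := cardC1 s; rewrite -/n => <-; exact: eq_card.
(* Since [s] is not in [l], its index is [size l = n.-1], which is out of range, and [insub] sends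
   it to [None]. *)
pose f y : option 'I_n.-1 := insub (index y l).
have fs : f s = None by rewrite /f insubF // -sl index_mem mem_l eqxx.
have fE y : y != s -> exists2 i : 'I_n.-1, f y = Some i & val i = index y l.
  move=> ys; have lt : index y l < n.-1 by rewrite -sl index_mem mem_l.
  by exists (Ordinal lt) => //; rewrite /f insubT; congr Some; apply: val_inj.
have injf : injective f.
  move=> u v; have [->|us] := eqVneq u s; have [->|vs] := eqVneq v s => //.
  - by rewrite fs; case: (fE v vs) => i ->.
  - by rewrite fs; case: (fE u us) => i ->.
  case: (fE u us) => i -> Ei; case: (fE v vs) => j -> Ej [E].
  have := Ei; rewrite E Ej => /esym EE.
  by rewrite -(nth_index s (_ : u \in l)) ?mem_l // EE nth_index // mem_l.
exists f.
  apply: inj_card_bij injf _; rewrite card_option card_ord prednK //.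
  by apply/card_gt0P; exists s.
have cardN y : y != s -> (index y l < #|N|) = adj s y.
  move=> ys; rewrite /l index_cat mem_enum inE; case: ifP => sy.
    by rewrite cardE index_mem mem_enum inE.
  by rewrite cardE ltnNge leq_addr.
move=> u v; have [->|us] := eqVneq u s; have [->|vs] := eqVneq v s.
- by rewrite fs /= adj_irr.
- by rewrite fs; case: (fE v vs) => i -> /= ->; exact: cardN.
- by rewrite fs; case: (fE u us) => i -> /= ->; rewrite adj_sym cardN.
case: (fE u us) => i Eu Ei; case: (fE v vs) => j Ev Ej; rewrite Eu Ev /=.
have [E|uv] := eqVneq u v.
  by move: Ev; rewrite -E Eu adj_irr => -[->]; rewrite eqxx.
rewrite clique //; apply/eqP => Eij; case/eqP: uv; apply: injf.
by rewrite Eu Ev Eij.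
Qed.

Lemma k_connected_connect (G : sgraph) : k_connected 2 G ->
  forall u v : G, connect (@adj G) u v.
Proof.
case=> _ /(_ set0); rewrite cards0 => /(_ isT) c0 u v.
have := c0 u v; rewrite !inE => /(_ isT isT).
by apply: connect_sub => r s /andP[_]; exact: connect1.
Qed.

Lemma iso_complete (G : sgraph) : (forall u v : G, u != v -> adj u v) ->
  graph_iso G (complete_graph #|G|).
Proof.
move=> clique; exists (@enum_rank G).
  by exists (@enum_val G predT); [exact: enum_rankK | exact: enum_valK].
move=> u v; rewrite /= /complete_rel /= (inj_eq enum_rank_inj).
by have [->|uv] := eqVneq u v; rewrite ?adj_irr // clique.
Qed.

Lemma dominated_total (G : sgraph) (w : G) : 6 <= gorder G -> k_connected 2 G ->
  unexceptional (gorder G) G -> (forall y, y != w -> adj w y) ->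
  4 * gorder G <= total_excess G + 8.
Proof.
move=> G6 conn2 unexc dom; have conn := k_connected_connect conn2.
apply: contraT => hard; exfalso; apply: unexc.
have [/existsP[u /existsP[v /andP[uv nuv]]]|complete] :=
    boolP [exists u : G, exists v : G, (u != v) && ~~ adj u v]; last first.
  apply: Or31; apply: iso_complete => u v uv; apply: contraNT complete => nuv.
  by apply/existsP; exists u; apply/existsP; exists v; rewrite uv.
have [s [clique cardN]] := hard_exceptional conn conn2 dom G6 hard uv nuv.
have := iso_ext_complete clique.
by case: cardN => ->; [exact: Or32 | exact: Or33].
Qed.

(** Outside the degree-two case there is a pentagon, and the chords decide: one is a house, none a
    5-cycle, two a gem. A gem with an obstruction is passed to the induction hypothesis for the
    graph without the near side. *)
Lemma light_vertex_total (G : sgraph) (x : G) :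
  (forall H : sgraph, gorder H < gorder G -> 6 <= gorder H -> k_connected 2 H ->
    unexceptional (gorder H) H -> 4 * gorder H <= total_excess H + 8) ->
  6 <= gorder G -> k_connected 2 G ->
  (forall w : G, exists2 y, y != w & ~~ adj w y) ->
  excess_to [set: G] x <= 3 -> 4 * gorder G <= total_excess G + 8.
Proof.
move=> IH G6 conn2 nodom light; have conn := k_connected_connect conn2.
have [multi|] := boolP [forall v, (1 < dist x v) ==> (1 < #|level x v 1|)].
  have [|| v [w1 [w2 [xadj nxv xv nw vadj]]]] := light_typeA conn light.
  - by move=> v; apply/implyP; move/forallP: multi.
  - by have [y yx nxy] := nodom x; exists y; apply: nadj_dist; rewrite // eq_sym.
  exact: (total_deg2_nonneighbor conn conn2 xadj nxv xv nw vadj nodom).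
case/forallPn => v; rewrite negb_imply -leqNgt => /andP[fv v1].
have [w [w' [b [z [B [B' P]]]]]] := light_typeB conn conn2 light fv v1.
have [house|] := boolP (adj z w != adj w w'); first exact: (pent_house conn P).
rewrite negbK => /eqP same; have [zw|zw] := boolP (adj z w); last first.
  by apply: (pent_c5 conn conn2 P) => //; rewrite -same.
have ww : adj w w' by rewrite -same.
have [/existsP[y obs]|none] := boolP [exists y, gem_obstruction w w' b z B y].
  have [/andP[Q6 QG] conn2Q unexcQ] := gem_obstruction_reduction conn conn2 P zw ww obs.
  set Q := ~: _ in Q6 QG conn2Q unexcQ *; apply.
  have leQ := total_excess_induced conn (gem_geodesic conn P ww); rewrite -/Q in leQ.
  have := IH _ _ _ conn2Q unexcQ; rewrite gorder_induced => /(_ QG Q6) IHQ.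
  exact: leq_trans IHQ (leq_add leQ (leqnn 8)).
apply: (pent_gem conn P zw ww) => // y.
by apply: contraNN none => obs; apply/existsP; exists y.
Qed.

Lemma total_excess_ge (G : sgraph) : 6 <= gorder G -> k_connected 2 G ->
  unexceptional (gorder G) G -> 4 * gorder G <= total_excess G + 8.
Proof.
move En: (gorder G) => n; elim/ltn_ind: n G En => n IH G En n6 conn2 unexc.
rewrite -{}En in IH n6 unexc *.
have [/existsP[w /forall_inP dom]|] := boolP [exists w : G, [forall (y | y != w), adj w y]].
  exact: dominated_total dom.
rewrite negb_exists => /forallP nodom.
have {}nodom (w : G) : exists2 y, y != w & ~~ adj w y.
  by have /forall_inPn[y] := nodom w; exists y.
have [/forallP heavy|/forallPn[x]] := boolP [forall x, 4 <= excess_to [set: G] x].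
  have -> : total_excess G = \sum_(x : G) excess_to [set: G] x.
    by apply: eq_bigr => x _; apply: eq_bigl => y; rewrite inE.
  rewrite {1}/gorder -sum1_card big_distrr /=.
  apply: leq_trans (leq_addr _ _); apply: leq_sum => x _; rewrite muln1; exact: heavy.
rewrite -ltnNge ltnS; apply: light_vertex_total => // H HG H6 conn2H unexcH.
exact: (IH _ HG H erefl).
Qed.

Theorem theorem3 (n : nat) (G : sgraph) (n_ge6 : 6 <= n) (orderG : #|G| = n)
    (conn2G : k_connected 2 G) (unexcG : unexceptional n G) :
  (2 * n%:Z - 4 <= sz_w_gap G)%R.
Proof.
rewrite -orderG -/(gorder G) in n_ge6 unexcG *.
have := total_excess_ge n_ge6 conn2G unexcG.
have := szeged_wiener (k_connected_connect conn2G).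
(* The total excess is twice the gap, so 4n - 8 becomes 2n - 4. *)
by rewrite /sz_w_gap; move: (szeged G) (wiener G) (total_excess G) (gorder G); lia.
Qed.
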